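(* (i) Every Banach lattice that is of universal disposition for the class of separable Banach lattices is $1$-separably $\mathcal{BL}$-injective. (ii) Every Banach lattice of the form $L_1(\mu)$ that is of universal disposition for the class of separable Banach lattices of the form $L_1(\nu)$ is $1$-separably $\mathcal{BL}$-injective.
   Context: Banach lattices are real. Lattice homomorphisms are bounded linear operators commuting with the lattice operations; an embedding is a norm-preserving lattice homomorphism. For a class $\mathcal{C}$ of Banach lattices, a Banach lattice $X$ is of universal disposition for $\mathcal{C}$ if for all embeddings $f:R\to S$ and $g:R\to X$ of Banach lattices with $S\in\mathcal{C}$, there exists an embedding $h:S\to X$ with $h\circ f=g$. For $\lambda>0$, a Banach lattice $Z$ is $\lambda$-separably $\mathcal{BL}$-injective if for every separable Banach lattice $Y$, every closed sublattice $X$ of $Y$ and every lattice homomorphism $T:X\to Z$, there exists a lattice homomorphism $\tilde T:Y\to Z$ extending $T$ with $\|\tilde T\|\leq\lambda\|T\|$. A Banach lattice is of the form $L_1(\mu)$ if it is lattice isometric to $L_1(\mu)$ for some positive measure $\mu$. *)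

(* Defs.v *)
From HB Require Import structures.
From mathcomp Require Import all_boot all_order all_algebra.
From mathcomp Require Import all_classical all_reals all_analysis.

Set Implicit Arguments.
Unset Strict Implicit.
Unset Printing Implicit Defensive.

Import Order.TTheory GRing.Theory Num.Theory.
Import numFieldNormedType.Exports.

Local Open Scope classical_set_scope.
Local Open Scope ring_scope.

(* The order and the lattice operations are fields of their own: Hierarchy
   Builder refuses the join of [CompleteNormedModule] with [Order.Lattice] (or
   [Order.POrder]), because [Num.NumDomain] inherits from the bases of both
   without inheriting from such a join.
   [`|x|] is the norm; the lattice absolute value is [lat_join x (- x)]. *)
HB.mixin Record isBanachLattice (R : realType) V
    & CompleteNormedModule R V := {
  lat_le : rel V ;
  lat_join : V -> V -> V ;
  lat_meet : V -> V -> V ;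
  lat_le_refl : reflexive lat_le ;
  lat_le_anti : antisymmetric lat_le ;
  lat_le_trans : transitive lat_le ;
  lat_leUx : forall x y z : V,
    lat_le (lat_join x y) z = lat_le x z && lat_le y z ;
  lat_lexI : forall x y z : V,
    lat_le x (lat_meet y z) = lat_le x y && lat_le x z ;
  lat_leD2r : forall x y z : V, lat_le x y -> lat_le (x + z) (y + z) ;
  lat_scale_ge0 : forall (a : R) (x : V),
    0 <= a -> lat_le 0 x -> lat_le 0 (a *: x) ;
  lat_le_norm : forall x y : V,
    lat_le (lat_join x (- x)) (lat_join y (- y)) -> `|x| <= `|y|
}.

#[short(type="banachLatticeType")]
HB.structure Definition BanachLattice (R : realType) :=
  { V of CompleteNormedModule R V & isBanachLattice R V }.

Section BanachLattices.
Context {R : realType}.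
Implicit Types X Y Z S : banachLatticeType R.

(* A map defined on a sublattice [A] of [X] is encoded by a total function on
   [X] of which only the values on [A] matter. *)
Definition lattice_hom_on X Y (A : set X) (f : X -> Y) : Prop :=
  [/\ forall (a : R) x y, A x -> A y -> f (a *: x + y) = a *: f x + f y,
      forall x y, A x -> A y -> f (lat_join x y) = lat_join (f x) (f y),
      forall x y, A x -> A y -> f (lat_meet x y) = lat_meet (f x) (f y) &
      exists M : R, forall x, A x -> `|f x| <= M * `|x| ].

Definition lattice_hom X Y (f : X -> Y) : Prop := lattice_hom_on [set: X] f.

Definition opnorm_on X Y (A : set X) (f : X -> Y) : R :=
  sup [set `|f x| | x in A `&` [set x | `|x| <= 1]].

Definition opnorm X Y (f : X -> Y) : R := opnorm_on [set: X] f.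

Definition embedding X Y (f : X -> Y) : Prop :=
  lattice_hom f /\ forall x, `|f x| = `|x|.

Definition closed_sublattice X (A : set X) : Prop :=
  [/\ closed A,
      A 0,
      forall (a : R) x y, A x -> A y -> A (a *: x + y),
      forall x y, A x -> A y -> A (lat_join x y) &
      forall x y, A x -> A y -> A (lat_meet x y)].

Definition separable (T : topologicalType) : Prop :=
  exists2 D : set T, countable D & dense D.

Definition universal_disposition (C : banachLatticeType R -> Prop) X : Prop :=
  forall (E S : banachLatticeType R) (f : E -> S) (g : E -> X),
    C S -> embedding f -> embedding g ->
    exists2 h : S -> X, embedding h & h \o f = g.

Definition separably_BL_injective (lambda : R) Z : Prop :=
  forall (Y : banachLatticeType R) (A : set Y) (T : Y -> Z),
    separable Y -> closed_sublattice A -> lattice_hom_on A T ->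
    exists T' : Y -> Z,
      [/\ lattice_hom T',
          forall x, A x -> T' x = T x &
          opnorm T' <= lambda * opnorm_on A T].

(* The library's [LspaceType1 mu] consists of the classes, modulo equality
   almost everywhere, of the real-valued mu-integrable functions, but it
   carries neither a module nor an order structure: its (pointwise a.e.)
   operations are therefore described on representatives. *)
Definition L1_lattice_isometry d (T : measurableType d)
    (mu : {measure set T -> \bar R}) X (J : LspaceType1 mu -> X) : Prop :=
  [/\ bijective J,
      forall (a : R) (f g h : LspaceType1 mu),
        (h : T -> R) = (fun t => a * (f t : R) + (g t : R)) %[ae mu] ->
        J h = a *: J f + J g,
      forall f g h : LspaceType1 mu,
        (h : T -> R) = (fun t => Num.max (f t : R) (g t : R)) %[ae mu] ->
        J h = lat_join (J f) (J g),
      forall f g h : LspaceType1 mu,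
        (h : T -> R) = (fun t => Num.min (f t : R) (g t : R)) %[ae mu] ->
        J h = lat_meet (J f) (J g) &
      forall f : LspaceType1 mu,
        (`|J f|%:E = 'N[mu]_1[EFin \o (f : T -> R)])%E].

Definition is_L1 X : Prop :=
  exists (d : measure_display) (T : measurableType d)
         (mu : {measure set T -> \bar R}) (J : LspaceType1 mu -> X),
    L1_lattice_isometry J.

End BanachLattices.

(* Main.v *)
(** Both parts rest on the same reduction. Let [Y] be separable, [A] a closed
    sublattice of [Y], [T : A -> X] a lattice homomorphism and [M] its norm.
    Suppose that [q] is a lattice seminorm on [Y] with [q <= M |.|] and
    [q a = |T a|] on [A]. Then [T] induces an embedding into [X] of the
    completion [E] of [A] for [|T .|], and [E] embeds in the completion [S] of
    [Y] for [q]; universal disposition gives an embedding [h : S -> X] over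
    [E], and [Y -> S -> X] extends [T] with norm at most [M].

    For (i), take [q y = inf {|T a| + M |b| : a in A, |y| <= a + b}] with
    [a, b >= 0].

    For (ii), [q] must moreover be additive on the positive cone, so that [S] is
    an AL-space. As the norm of [X] is additive on positive elements,
    [a |-> |T a^+| - |T a^-|] is linear on [A] and dominated by [M |a^+|]; the
    Hahn-Banach theorem extends it to a positive functional [psi] on [Y], and
    [q y = psi |y|]. It remains to embed a separable AL-space [Z] in the
    separable space [L1(R)] of the Lebesgue measure (instead of representing [Z]
    itself by a measure): [Z] has a weak unit [e] and a sequence of components
    of [e] with dense linear span; the atoms of the Boolean algebras that the
    first [n] of them generate form a binary tree, which is copied in [L1(R)] by
    a tree of adjacent intervals whose lengths are the norms of the atoms. *)

Require Import Defs.
From HB Require Import structures.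
From mathcomp Require Import all_boot all_order all_algebra.
From mathcomp Require Import all_classical all_reals all_analysis.
From mathcomp Require Import measurable_realfun ring lra.

Set Implicit Arguments.
Unset Strict Implicit.
Unset Printing Implicit Defensive.

Import Order.TTheory GRing.Theory Num.Theory.
Import numFieldNormedType.Exports.

Local Open Scope classical_set_scope.
Local Open Scope ring_scope.

(** The homomorphism [T] is in general neither isometric nor injective, whereas universal
    disposition speaks of embeddings only. Changing the norms of [A] and [Y] until [T] and the
    inclusion become isometric makes it applicable, at the cost of seminorms with kernels; a
    completion is therefore a quotient of Cauchy sequences, and the same quotient construction
    serves for [L_1]. Maps out of the completions are known on dense sets only, whose points have no
    preferred preimage: they are handled as norm-preserving linear relations and closed up in the
    product. For (ii) the seminorm of (i) would not do, because an infimal convolution need not be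
    additive on the cone. In an AL-space the norm of a step function depends only on the masses of
    its pieces; this is why copying a tree of pieces with the right masses already yields an
    isometry. *)

(** * Vector lattices *)

(* [ring] does not apply to modules; this decides the identities of abelian
   groups by reflection. *)
Inductive zexp := ZVar of nat | ZZero | ZAdd of zexp & zexp | ZOpp of zexp.

Fixpoint zcoef (e : zexp) (i : nat) : int :=
  match e with
  | ZVar k => ((k == i) : nat)%:Z
  | ZZero => 0
  | ZAdd a b => zcoef a i + zcoef b i
  | ZOpp a => - zcoef a i
  end.

Fixpoint zeval (V : zmodType) (env : seq V) (e : zexp) : V :=
  match e with
  | ZVar k => nth 0 env k
  | ZZero => 0
  | ZAdd a b => zeval env a + zeval env b
  | ZOpp a => - zeval env a
  end.

Lemma zevalE (V : zmodType) (env : seq V) (e : zexp) :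
  zeval env e = \sum_(i < size env) nth 0 env i *~ zcoef e i.
Proof.
elim: e => [k||a IHa b IHb|a IHa] /=.
- case: (ltnP k (size env)) => [kn|kn].
    rewrite (bigD1 (Ordinal kn))//= eqxx mulr1z big1 ?addr0// => i ik.
    by rewrite -(inj_eq val_inj) /= eq_sym in ik; rewrite (negbTE ik) mulr0z.
  rewrite nth_default// big1// => i _.
  by rewrite gtn_eqF ?mulr0z// (leq_trans (ltn_ord i)).
- by rewrite big1// => i _; rewrite mulr0z.
- by rewrite IHa IHb -big_split; apply: eq_bigr => i _; rewrite mulrzDr.
- by rewrite IHa -sumrN; apply: eq_bigr => i _; rewrite mulrNz.
Qed.

Lemma zeval_eq (V : zmodType) (env : seq V) (e f : zexp) :
  all (fun i => zcoef e i == zcoef f i) (iota 0 (size env)) ->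
  zeval env e = zeval env f.
Proof.
move=> /allP ef; rewrite !zevalE; apply: eq_bigr => i _; congr (_ *~ _).
by apply/eqP/ef; rewrite mem_iota add0n /=.
Qed.

(* Atoms are compared up to conversion: the group structure of one type may be
   reached through different canonical paths. *)
Ltac zmem x l :=
  lazymatch l with
  | nil => constr:(false)
  | ?y :: ?l' =>
      match constr:(true) with
      | _ => let _ := match constr:(true) with _ => unify x y end in
             constr:(true)
      | _ => zmem x l'
      end
  end.

Ltac zatoms t l :=
  lazymatch t with
  | (?a + ?b)%R => let l1 := zatoms a l in zatoms b l1
  | (- ?a)%R => zatoms a l
  | 0%R => l
  | _ => let m := zmem t l in
         lazymatch m with true => l | false => constr:(t :: l) end
  end.

Ltac zindex x l :=
  lazymatch l with
  | ?y :: ?l' =>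
      match constr:(true) with
      | _ => let _ := match constr:(true) with _ => unify x y end in
             constr:(0%N)
      | _ => let n := zindex x l' in constr:(n.+1)
      end
  end.

Ltac zreify t l :=
  lazymatch t with
  | (?a + ?b)%R =>
      let a' := zreify a l in let b' := zreify b l in constr:(ZAdd a' b')
  | (- ?a)%R => let a' := zreify a l in constr:(ZOpp a')
  | 0%R => constr:(ZZero)
  | _ => let n := zindex t l in constr:(ZVar n)
  end.

Ltac zmod :=
  lazymatch goal with
  | |- @eq ?T ?a ?b =>
      let l0 := zatoms a (@nil T) in
      let l := zatoms b l0 in
      let a' := zreify a l in
      let b' := zreify b l in
      exact: (@zeval_eq _ l a' b' erefl)
  end.

(** Equations on the join alone: order and meet are derived from it, so that the structure passes
    pointwise to functions and sequences, and to quotients. *)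
Record vlattice (R : realType) (V : lmodType R) (j : V -> V -> V) : Prop :=
  VLattice {
  vl_idem : forall x, j x x = x ;
  vl_joinC : forall x y, j x y = j y x ;
  vl_joinA : forall x y z, j x (j y z) = j (j x y) z ;
  vl_joinD : forall x y z, j (x + z) (y + z) = j x y + z ;
  vl_joinZ : forall (a : R) x y, 0 <= a -> j (a *: x) (a *: y) = a *: j x y
}.

Section VectorLattice.
Context {R : realType} {V : lmodType R}.
Variable j : V -> V -> V.
Implicit Types (x y z : V) (a : R).

Definition vle x y : Prop := j x y = y.
Definition vmeet x y : V := x + y - j x y.
Definition vpos x : V := j x 0.
Definition vabs x : V := j x (- x).

Hypothesis H : vlattice j.

Local Notation "x <=| y" := (vle x y) (at level 70).

Lemma vle_refl x : x <=| x. Proof. exact: vl_idem H x. Qed.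

Lemma vle_trans y x z : x <=| y -> y <=| z -> x <=| z.
Proof. by rewrite /vle => xy yz; rewrite -yz (vl_joinA H) xy. Qed.

Lemma vle_anti x y : x <=| y -> y <=| x -> x = y.
Proof. by move=> xy yx; rewrite -[LHS]yx (vl_joinC H). Qed.

Lemma vleUl x y : x <=| j x y.
Proof. by rewrite /vle (vl_joinA H) (vl_idem H). Qed.

Lemma vleUr x y : y <=| j x y.
Proof. by rewrite (vl_joinC H); exact: vleUl. Qed.

Lemma vleUx x y z : x <=| z -> y <=| z -> j x y <=| z.
Proof. by rewrite /vle => xz yz; rewrite -(vl_joinA H) yz xz. Qed.

Lemma vleU2 x y x' y' : x <=| x' -> y <=| y' -> j x y <=| j x' y'.
Proof.
move=> xx yy; apply: vleUx; first exact: vle_trans xx (vleUl _ _).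
exact: vle_trans yy (vleUr _ _).
Qed.

Lemma vleD2r z x y : x <=| y -> x + z <=| y + z.
Proof. by rewrite /vle (vl_joinD H) => ->. Qed.

Lemma vleD x y x' y' : x <=| x' -> y <=| y' -> x + y <=| x' + y'.
Proof.
move=> xx yy; apply: (vle_trans (vleD2r y xx)).
by rewrite ![x' + _]addrC; exact: vleD2r.
Qed.

Lemma vle_subr x y z : x + z <=| y -> x <=| y - z.
Proof. by move=> /(vleD2r (- z)); rewrite addrK. Qed.

Lemma vle_addr x y z : x - z <=| y -> x <=| y + z.
Proof. by move=> /(vleD2r z); rewrite subrK. Qed.

Lemma vsub_ge0 x y : x <=| y -> 0 <=| y - x.
Proof. by move=> h; apply: vle_subr; rewrite add0r. Qed.

Lemma vsubr_ge0 x y : 0 <=| y - x -> x <=| y.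
Proof. by move=> /(vleD2r x); rewrite add0r subrK. Qed.

Lemma vleN x y : x <=| y -> - y <=| - x.
Proof.
move=> /(vleD2r (- x - y)).
by rewrite addrA subrr add0r addrCA subrr addr0.
Qed.

Lemma vleZ a x y : 0 <= a -> x <=| y -> a *: x <=| a *: y.
Proof. by rewrite /vle => a0; rewrite (vl_joinZ H) // => ->. Qed.

Lemma vle0D x y : 0 <=| x -> 0 <=| y -> 0 <=| x + y.
Proof. by move=> x0 y0; rewrite -(addr0 0); exact: vleD. Qed.

Lemma vle_paddr x y z : 0 <=| z -> x <=| y -> x <=| y + z.
Proof. by move=> z0 xy; rewrite -(addr0 x); exact: vleD. Qed.

Lemma vle0Z a x : 0 <= a -> 0 <=| x -> 0 <=| a *: x.
Proof. by move=> a0 x0; rewrite -(scaler0 _ a); exact: vleZ. Qed.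

Lemma vmeetE x y : vmeet x y = - j (- x) (- y).
Proof.
rewrite /vmeet (vl_joinC H (- x)).
have -> : j (- y) (- x) = j x y - (x + y).
  by rewrite -(vl_joinD H); congr j; zmod.
by rewrite opprB.
Qed.

Lemma vmeetC x y : vmeet x y = vmeet y x.
Proof. by rewrite /vmeet [x + y]addrC (vl_joinC H). Qed.

Lemma vleIl x y : vmeet x y <=| x.
Proof. by rewrite vmeetE -[X in _ <=| X]opprK; apply: vleN; exact: vleUl. Qed.

Lemma vleIr x y : vmeet x y <=| y.
Proof. by rewrite vmeetC; exact: vleIl. Qed.

Lemma vlexI x y z : z <=| x -> z <=| y -> z <=| vmeet x y.
Proof.
move=> zx zy; rewrite vmeetE -[z]opprK; apply: vleN.
by apply: vleUx; exact: vleN.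
Qed.

Lemma vleI2 x y x' y' : x <=| x' -> y <=| y' -> vmeet x y <=| vmeet x' y'.
Proof.
move=> xx yy; apply: vlexI; first exact: vle_trans (vleIl _ _) xx.
exact: vle_trans (vleIr _ _) yy.
Qed.

Lemma vmeet_ge0 x y : 0 <=| x -> 0 <=| y -> 0 <=| vmeet x y.
Proof. exact: vlexI. Qed.

Lemma vmeet_l x y : x <=| y -> vmeet x y = x.
Proof. by rewrite /vle /vmeet => ->; rewrite addrK. Qed.

Lemma vmeetA x y z : vmeet x (vmeet y z) = vmeet (vmeet x y) z.
Proof. by rewrite !vmeetE !opprK (vl_joinA H). Qed.

Lemma vjoin_meet x y : j x y + vmeet x y = x + y.
Proof. by rewrite /vmeet addrC subrK. Qed.

Lemma vmeetD x y z : vmeet (x + z) (y + z) = vmeet x y + z.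
Proof.
by rewrite /vmeet (vl_joinD H); zmod.
Qed.

Lemma vmeetZ a x y : 0 <= a -> vmeet (a *: x) (a *: y) = a *: vmeet x y.
Proof. by move=> a0; rewrite /vmeet (vl_joinZ H)// scalerBr scalerDr. Qed.

Lemma vabs_gex x : x <=| vabs x. Proof. exact: vleUl. Qed.

Lemma vabsN x : vabs (- x) = vabs x.
Proof. by rewrite /vabs opprK (vl_joinC H). Qed.

Lemma vabs_geN x : - x <=| vabs x. Proof. exact: vleUr. Qed.

Lemma vabs_le x y : x <=| y -> - x <=| y -> vabs x <=| y.
Proof. exact: vleUx. Qed.

Lemma vhalf x : (2^-1 : R) *: (x + x) = x.
Proof. by rewrite -mulr2n -[x *+ 2]scaler_nat scalerA mulVf ?scale1r// pnatr_eq0. Qed.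

Lemma vabs_ge0 x : 0 <=| vabs x.
Proof.
rewrite -(vhalf (vabs x)); apply: vle0Z => //.
by rewrite -(subrr x); apply: vleD; [exact: vabs_gex | exact: vabs_geN].
Qed.

Lemma vabs_id x : 0 <=| x -> vabs x = x.
Proof.
move=> x0; apply: vle_anti (vabs_gex x); apply: vabs_le; first exact: vle_refl.
by apply: vle_trans (x0); rewrite -[X in _ <=| X]oppr0; exact: vleN.
Qed.

Lemma vabs_abs x : vabs (vabs x) = vabs x.
Proof. exact/vabs_id/vabs_ge0. Qed.

Lemma vabsD x y : vabs (x + y) <=| vabs x + vabs y.
Proof.
apply: vabs_le; first by apply: vleD; exact: vabs_gex.
by rewrite opprD; apply: vleD; exact: vabs_geN.
Qed.

Lemma vabsZ a x : vabs (a *: x) = `|a| *: vabs x.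
Proof.
wlog a0 : a / 0 <= a.
  move=> h; case: (leP 0 a) => [|/ltW]; first exact: h.
  by rewrite -oppr_ge0 => /h; rewrite scaleNr vabsN normrN.
by rewrite ger0_norm// /vabs -scalerN (vl_joinZ H).
Qed.

Lemma vabs_le_pos x y : 0 <=| x -> x <=| y -> vabs x <=| vabs y.
Proof. by move=> x0 xy; rewrite !vabs_id//; exact: vle_trans xy. Qed.

Lemma vpos_ge0 x : 0 <=| vpos x. Proof. exact: vleUr. Qed.

Lemma vpos_ge x : x <=| vpos x. Proof. exact: vleUl. Qed.

Lemma vpos_le x y : x <=| y -> vpos x <=| vpos y.
Proof. by move=> xy; apply: vleU2 xy (vle_refl _). Qed.

Lemma vpos_id x : 0 <=| x -> vpos x = x.
Proof. by rewrite /vle /vpos (vl_joinC H). Qed.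

Lemma vpos_lub x y : x <=| y -> 0 <=| y -> vpos x <=| y.
Proof. exact: vleUx. Qed.

Lemma vpos_le_abs x : vpos x <=| vabs x.
Proof. by apply: vpos_lub; [exact: vabs_gex | exact: vabs_ge0]. Qed.

Lemma vpos_subN x : vpos x - vpos (- x) = x.
Proof.
have -> : vpos x = vpos (- x) + x; last by zmod.
by rewrite /vpos -(vl_joinD H) addNr add0r (vl_joinC H).
Qed.

Lemma vjoin_pos x y : j x y = x + vpos (y - x).
Proof. by rewrite addrC /vpos -(vl_joinD H) subrK add0r (vl_joinC H). Qed.

(** For disjoint elements [j p m = p + m], hence [j (p - m) 0 = j p m - m = p]: a decomposition into
    disjoint parts is the canonical one. *)
Lemma vpos_sub_disjoint p m : vmeet p m = 0 -> vpos (p - m) = p.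
Proof.
move=> pm; rewrite /vpos -(subrr m) (vl_joinD H).
by apply/eqP; rewrite subr_eq -(vjoin_meet p m) pm addr0.
Qed.

Lemma vpos_disjoint x : vmeet (vpos x) (vpos (- x)) = 0.
Proof.
have -> : vpos (- x) = vpos x - x.
  by rewrite -[X in _ - X](vpos_subN x) opprB addrC subrK.
rewrite -{1}(addr0 (vpos x)) ![vpos x + _]addrC vmeetD vmeetE oppr0 opprK.
by rewrite (vl_joinC H) -/(vpos x) addNr.
Qed.

(** With [u = vmeet x (y + z)], the difference [u - vmeet x y] is the join of [u - x], which is
    negative, and of [u - y]; both lie below [vmeet x z]. *)
Lemma vmeet_addr_le x y z : 0 <=| x -> 0 <=| y -> 0 <=| z ->
  vmeet x (y + z) <=| vmeet x y + vmeet x z.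
Proof.
move=> x0 y0 z0; set u := vmeet x (y + z).
have ux : u <=| x by exact: vleIl.
have uyz : u <=| z + y by rewrite addrC; exact: vleIr.
rewrite addrC; apply: vle_addr; rewrite (vmeetE x y) opprK addrC -(vl_joinD H).
have ux0 : - x + u <=| 0 by rewrite addrC -(subrr x); exact: vleD2r.
apply: vleUx; first exact: vle_trans ux0 (vmeet_ge0 x0 z0).
rewrite addrC; apply: vlexI.
  apply: vle_trans ux; rewrite -[X in _ <=| X]addr0; apply: vleD (vle_refl _) _.
  by rewrite -oppr0; exact: vleN.
by rewrite -[z](addrK y); exact: vleD2r.
Qed.

(** One inequality is the subadditivity of [vmeet x]. For the other, the two parts are disjoint, so
    that their sum is their join, which lies below [x]. *)
Lemma vmeet_split c d x : 0 <=| x -> 0 <=| c -> 0 <=| d -> vmeet c d = 0 ->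
  x <=| c + d -> vmeet x c + vmeet x d = x.
Proof.
move=> x0 c0 d0 cd xcd; apply: vle_anti.
  rewrite -(vjoin_meet (vmeet x c)); set m := vmeet (vmeet x c) _.
  have -> : m = 0.
    apply: vle_anti; last by do 2!apply: vmeet_ge0 => //; exact: vmeet_ge0.
    by rewrite -cd; apply: vleI2; exact: vleIr.
  by rewrite addr0; apply: vleUx; exact: vleIl.
by rewrite -[X in X <=| _](vmeet_l xcd); exact: vmeet_addr_le.
Qed.

Lemma vmeet0_le x y x' y' : 0 <=| x -> 0 <=| y -> x <=| x' -> y <=| y' ->
  vmeet x' y' = 0 -> vmeet x y = 0.
Proof.
move=> x0 y0 xx yy xy; apply: vle_anti; last exact: vmeet_ge0.
by rewrite -xy; exact: vleI2.
Qed.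

Lemma vmeet0D x y z : 0 <=| x -> 0 <=| y -> 0 <=| z ->
  vmeet x y = 0 -> vmeet x z = 0 -> vmeet x (y + z) = 0.
Proof.
move=> x0 y0 z0 xy xz; apply: vle_anti.
  apply: vle_trans (vmeet_addr_le x0 y0 z0) _.
  by rewrite xy xz addr0; exact: vle_refl.
by apply: vmeet_ge0 => //; exact: vle0D.
Qed.

(** Both [x] and [a *: y] lie below the multiples of [x] and [y] by [1 + a], which are again
    disjoint. *)
Lemma vmeet0Z a x y : 0 <= a -> 0 <=| x -> 0 <=| y ->
  vmeet x y = 0 -> vmeet x (a *: y) = 0.
Proof.
move=> a0 x0 y0 xy.
have a1 : 0 <= 1 + a by rewrite addr_ge0.
apply: vmeet0_le (_ : vmeet ((1 + a) *: x) ((1 + a) *: y) = 0) => //.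
- exact: vle0Z.
- by rewrite scalerDl scale1r -{1}(addr0 x); apply: vleD (vle_refl _) _; exact: vle0Z.
- rewrite scalerDl scale1r addrC; apply: vle_paddr => //; exact: vle_refl.
- by rewrite vmeetZ// xy scaler0.
Qed.

(** [x + y] is the difference of [vpos x + vpos y] and [vpos (- x) + vpos (- y)]. These are
    disjoint: the two parts of one element are, and parts of different elements lie below [u] and
    [v]. *)
Lemma vposD_disjoint u v x y : 0 <=| u -> 0 <=| v -> vmeet u v = 0 ->
  vabs x <=| u -> vabs y <=| v -> vpos (x + y) = vpos x + vpos y.
Proof.
move=> u0 v0 uv xu yv.
have dis p q : 0 <=| p -> 0 <=| q -> p <=| vabs x -> q <=| vabs y ->
    vmeet p q = 0.
  move=> p0 q0 px qy.
  by apply: vmeet0_le uv => //; [exact: vle_trans xu | exact: vle_trans yv].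
have posN_le z : vpos (- z) <=| vabs z by rewrite -vabsN; exact: vpos_le_abs.
rewrite -[in LHS](vpos_subN x) -[in LHS](vpos_subN y) addrACA -opprD.
apply: vpos_sub_disjoint.
have gx := vpos_ge0 x; have gy := vpos_ge0 y.
have gx' := vpos_ge0 (- x); have gy' := vpos_ge0 (- y).
apply: vmeet0D => //; first exact: vle0D.
- rewrite vmeetC; apply: vmeet0D => //; first by rewrite vmeetC vpos_disjoint.
  exact: dis (vpos_le_abs _).
- rewrite vmeetC; apply: vmeet0D => //; last by rewrite vmeetC vpos_disjoint.
  by rewrite vmeetC; apply: dis => //; exact: vpos_le_abs.
Qed.

(** On disjoint pieces the join is computed piece by piece; [j x y = x + vpos (y - x)] reduces this
    to positive parts. *)
Lemma vjoinD_disjoint u v x y x' y' : 0 <=| u -> 0 <=| v -> vmeet u v = 0 ->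
  vabs x <=| u -> vabs y <=| u -> vabs x' <=| v -> vabs y' <=| v ->
  j (x + x') (y + y') = j x y + j x' y'.
Proof.
move=> u0 v0 uv xu yu xv yv.
rewrite !vjoin_pos addrACA; congr (_ + _).
have -> : y + y' - (x + x') = (y - x) + (y' - x') by rewrite opprD addrACA.
(* The bounds on [x] and [y] add up in [y - x], whence the factor 2. *)
apply: (@vposD_disjoint (2%:R *: u) (2%:R *: v)).
- exact: vle0Z.
- exact: vle0Z.
- by rewrite vmeetZ// uv scaler0.
- rewrite scaler_nat mulr2n; apply: vle_trans (vabsD _ _) _.
  by rewrite vabsN; exact: vleD.
- rewrite scaler_nat mulr2n; apply: vle_trans (vabsD _ _) _.
  by rewrite vabsN; exact: vleD.
Qed.

(** Two-variable form of Birkhoff's inequality: it makes the join Lipschitz for every lattice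
    seminorm, hence compatible with quotients and limits. *)
Lemma vabs_join x y x' y' :
  vabs (j x y - j x' y') <=| vabs (x - x') + vabs (y - y').
Proof.
have half p q p' q' : j p q - j p' q' <=| vabs (p - p') + vabs (q - q').
  rewrite -[X in _ <=| X](addrK (j p' q')); apply: vleD2r.
  apply: vle_trans (_ : j (p' + vabs (p - p') + vabs (q - q'))
                          (q' + vabs (p - p') + vabs (q - q')) <=| _) => //.
    apply: vleU2.
      apply: vle_paddr (vabs_ge0 _) _; rewrite addrC; apply: vle_addr.
      exact: vabs_gex.
    rewrite addrAC; apply: vle_paddr (vabs_ge0 _) _; rewrite addrC.
    by apply: vle_addr; exact: vabs_gex.
  by rewrite !(vl_joinD H) -addrA addrC; exact: vle_refl.
apply: vabs_le; first exact: half.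
rewrite opprB -(vabsN (x - _)) -(vabsN (y - _)) !opprB; exact: half.
Qed.

End VectorLattice.

(** * Banach lattices as vector lattices, and lattice seminorms *)

Section BanachLatticeTheory.
Context {R : realType} {X : banachLatticeType R}.
Implicit Types x y z : X.

Lemma lat_leE x y : lat_le x y <-> vle lat_join x y.
Proof.
split=> [xy|<-].
  apply: lat_le_anti; rewrite lat_leUx xy lat_le_refl /=.
  by have := lat_le_refl (lat_join x y); rewrite lat_leUx => /andP[].
by have := lat_le_refl (lat_join x y); rewrite lat_leUx => /andP[].
Qed.

Let leUl x y : lat_le x (lat_join x y).
Proof. by have := lat_le_refl (lat_join x y); rewrite lat_leUx => /andP[]. Qed.

Let leUr x y : lat_le y (lat_join x y).
Proof. by have := lat_le_refl (lat_join x y); rewrite lat_leUx => /andP[]. Qed.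

Let leUx x y z : lat_le x z -> lat_le y z -> lat_le (lat_join x y) z.
Proof. by rewrite lat_leUx => -> ->. Qed.

Let le_trans x y z : lat_le x y -> lat_le y z -> lat_le x z.
Proof. exact: lat_le_trans. Qed.

Lemma lat_vlattice : vlattice (@lat_join R X).
Proof.
have anti x y : lat_le x y -> lat_le y x -> x = y.
  by move=> xy yx; apply: lat_le_anti; rewrite xy.
split.
- by move=> x; apply: anti => //; apply: leUx; exact: lat_le_refl.
- by move=> x y; apply: anti; apply: leUx.
- move=> x y z; apply: anti.
    apply: leUx; first exact: le_trans (leUl _ _) (leUl _ _).
    by apply: leUx => //; exact: le_trans (leUr _ _) (leUl _ _).
  apply: leUx; last exact: le_trans (leUr _ _) (leUr _ _).
  by apply: leUx => //; exact: le_trans (leUl _ _) (leUr _ _).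
- move=> x y z; apply: anti; first by apply: leUx; exact: lat_leD2r.
  have h u v : lat_le u (v - z) -> lat_le (u + z) v.
    by move=> /(lat_leD2r _ _ z); rewrite subrK.
  apply: h; apply: leUx; rewrite -[X in lat_le X _](addrK z);
  exact: lat_leD2r.
- have Z (a : R) x y : 0 <= a -> lat_le x y -> lat_le (a *: x) (a *: y).
    move=> a0 /(lat_leD2r _ _ (- x)); rewrite subrr => /(lat_scale_ge0 _ _ a0).
    by move=> /(lat_leD2r _ _ (a *: x)); rewrite add0r scalerBr subrK.
  move=> a x y; rewrite le_eqVlt => /orP[/eqP <-|a0].
    by rewrite !scale0r; apply: anti => //; apply: leUx; exact: lat_le_refl.
  apply: anti; first by apply: leUx; apply: (Z); rewrite ?ltW.
  rewrite -[X in lat_le _ X](scalerKV (lt0r_neq0 a0)).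
  apply: (Z); first exact: ltW.
  by apply: leUx; rewrite -[X in lat_le X _](scalerK (lt0r_neq0 a0));
     apply: (Z); rewrite ?invr_ge0 ?(ltW a0).
Qed.

Lemma lat_meetE x y : lat_meet x y = vmeet lat_join x y.
Proof.
have H := lat_vlattice.
have := lat_le_refl (lat_meet x y); rewrite lat_lexI => /andP[/lat_leE mx /lat_leE my].
apply: (vle_anti H); first exact: (vlexI H).
by apply/lat_leE; rewrite lat_lexI; apply/andP; split; apply/lat_leE;
  [exact: (vleIl H)|exact: (vleIr H)].
Qed.

Lemma norm_vle x y :
  vle lat_join (vabs lat_join x) (vabs lat_join y) -> `|x| <= `|y|.
Proof. by move=> /lat_leE; exact: lat_le_norm. Qed.

End BanachLatticeTheory.

(* [D] is the domain of the lattice seminorm [N]; the lattice operations are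
   defined on the whole of [V]. *)
Record seminormed_lattice (R : realType) (V : lmodType R) (j : V -> V -> V)
    (D : set V) (N : V -> R) : Prop := SeminormedLattice {
  sl_vl : vlattice j ;
  sl_D0 : D 0 ;
  sl_Dlin : forall (a : R) x y, D x -> D y -> D (a *: x + y) ;
  sl_Dj : forall x y, D x -> D y -> D (j x y) ;
  sl_ND : forall x y, D x -> D y -> N (x + y) <= N x + N y ;
  sl_NZ : forall (a : R) x, D x -> N (a *: x) = `|a| * N x ;
  sl_Nle : forall x y, D x -> D y -> vle j (vabs j x) (vabs j y) -> N x <= N y
}.

Section SeminormedLattice.
Context {R : realType} {V : lmodType R} {j : V -> V -> V} {D : set V}.
Context {N : V -> R}.
Hypothesis H : seminormed_lattice j D N.
Implicit Types (x y : V) (a : R).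

Lemma sl_DZ a x : D x -> D (a *: x).
Proof. by move=> Dx; rewrite -[_ *: _]addr0; apply: (sl_Dlin H) => //; exact: sl_D0 H. Qed.

Lemma sl_DD x y : D x -> D y -> D (x + y).
Proof. by move=> Dx Dy; rewrite -[x]scale1r; exact: sl_Dlin H _ _ _ Dx Dy. Qed.

Lemma sl_DN x : D x -> D (- x).
Proof. by move=> Dx; rewrite -scaleN1r; exact: sl_DZ. Qed.

Lemma sl_DB x y : D x -> D y -> D (x - y).
Proof. by move=> Dx /sl_DN; exact: sl_DD. Qed.

Lemma sl_Dabs x : D x -> D (vabs j x).
Proof. by move=> Dx; apply: (sl_Dj H) => //; exact: sl_DN. Qed.

Lemma sl_Dpos x : D x -> D (vpos j x).
Proof. by move=> Dx; apply: (sl_Dj H) => //; exact: sl_D0 H. Qed.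

Lemma sl_N0 : N 0 = 0.
Proof. by rewrite -(scale0r 0) (sl_NZ H) ?normr0 ?mul0r//; exact: sl_D0 H. Qed.

Lemma sl_NN x : D x -> N (- x) = N x.
Proof. by move=> Dx; rewrite -scaleN1r (sl_NZ H)// normrN1 mul1r. Qed.

Lemma sl_NB x y : D x -> D y -> N (x - y) = N (y - x).
Proof. by move=> Dx Dy; rewrite -opprB sl_NN//; exact: sl_DB. Qed.

Lemma sl_N_ge0 x : D x -> 0 <= N x.
Proof.
move=> Dx; have := sl_ND H Dx (sl_DN Dx).
by rewrite subrr sl_N0 sl_NN// -mulr2n pmulrn_lge0.
Qed.

Lemma sl_Nabs x : D x -> N (vabs j x) = N x.
Proof.
move=> Dx; have Hv := sl_vl H; have Da := sl_Dabs Dx.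
by apply/eqP; rewrite eq_le !(sl_Nle H)// (vabs_abs Hv); exact: vle_refl.
Qed.

Lemma sl_Nle_pos x y : D x -> D y -> vle j 0 x -> vle j x y -> N x <= N y.
Proof.
move=> Dx Dy x0 xy; apply: (sl_Nle H) => //.
exact: (vabs_le_pos (sl_vl H) x0 xy).
Qed.

Lemma sl_Ntri x y z : D x -> D y -> D z -> N (x - z) <= N (x - y) + N (y - z).
Proof.
move=> Dx Dy Dz; have -> : x - z = (x - y) + (y - z) by zmod.
by apply: (sl_ND H); exact: sl_DB.
Qed.

Lemma sl_Ndist x y : D x -> D y -> `|N x - N y| <= N (x - y).
Proof.
move=> Dx Dy; have := sl_ND H (sl_DB Dx Dy) Dy; rewrite subrK => h1.
have := sl_ND H (sl_DB Dy Dx) Dx; rewrite subrK sl_NB// => h2.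
by rewrite ler_norml; apply/andP; split; lra.
Qed.

Lemma sl_Njoin x y x' y' : D x -> D y -> D x' -> D y' ->
  N (j x y - j x' y') <= N (x - x') + N (y - y').
Proof.
move=> Dx Dy Dx' Dy'; have Hv := sl_vl H.
have D1 := sl_DB Dx Dx'; have D2 := sl_DB Dy Dy'.
rewrite -(sl_Nabs D1) -(sl_Nabs D2).
apply: le_trans (sl_ND H (sl_Dabs D1) (sl_Dabs D2)).
apply: (sl_Nle H).
- by apply: sl_DB; exact: sl_Dj H _ _ _ _.
- by apply: sl_DD; exact: sl_Dabs.
- have s0 : vle j 0 (vabs j (x - x') + vabs j (y - y')).
    by apply: (vle0D Hv); exact: (vabs_ge0 Hv).
  by rewrite (vabs_id Hv s0); exact: (vabs_join Hv).
Qed.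

End SeminormedLattice.

Lemma norm_seminormed (R : realType) (X : banachLatticeType R) :
  seminormed_lattice (@lat_join R X) setT (fun x => `|x|).
Proof.
split=> //; first exact: lat_vlattice.
- by move=> x y _ _; exact: ler_normD.
- by move=> a x _; exact: normrZ.
- by move=> x y _ _; exact: norm_vle.
Qed.

(** Preservation of meets follows from that of joins, the meet being [x + y - lat_join x y]. *)
Lemma lattice_homP (R : realType) (X Y : banachLatticeType R) (A : set X)
    (f : X -> Y) :
  (forall (a : R) x y, A x -> A y -> f (a *: x + y) = a *: f x + f y) ->
  (forall x y, A x -> A y -> A (lat_join x y)) ->
  (forall x y, A x -> A y -> A (x + y)) ->
  (forall x y, A x -> A y -> f (lat_join x y) = lat_join (f x) (f y)) ->
  (exists M : R, forall x, A x -> `|f x| <= M * `|x|) ->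
  lattice_hom_on A f.
Proof.
move=> flin Aj AD fj fb; split=> // x y Ax Ay.
rewrite !lat_meetE /vmeet -fj//.
have -> : x + y - lat_join x y = (-1) *: lat_join x y + (x + y).
  by rewrite scaleN1r addrC.
rewrite flin; [|exact: Aj|exact: AD].
have -> : f (x + y) = f x + f y by rewrite -[x in LHS]scale1r flin// scale1r.
by rewrite scaleN1r addrC.
Qed.

(** * The Banach lattice of a complete seminormed lattice *)

(* Completeness is only required for sequences with summable increments. *)
Record cslat (R : realType) := CSLat {
  cs_car : lmodType R ;
  cs_join : cs_car -> cs_car -> cs_car ;
  cs_dom : set cs_car ;
  cs_norm : cs_car -> R ;
  cs_sl : seminormed_lattice cs_join cs_dom cs_norm ;
  cs_complete : forall u : nat -> cs_car, (forall n, cs_dom (u n)) ->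
    (forall n, cs_norm (u n.+1 - u n) <= 2^-1 ^+ n) ->
    exists2 l, cs_dom l & cs_norm (u n - l) @[n --> \oo] --> 0
}.

Lemma near_expr_lt (R : realType) (e : R) : 0 < e ->
  \forall n \near \oo, 2^-1 ^+ n < e :> R.
Proof.
move=> e0; have h : `|2^-1 : R| < 1 by rewrite ger0_norm ?invf_lt1 ?ltr1n.
have /cvgr0Pnorm_lt/(_ _ e0) := cvg_expr h.
by apply: filterS => n; rewrite ger0_norm// exprn_ge0.
Qed.

(** A Cauchy filter contains balls of radius [2^-1 ^+ n.+2]. Consecutive ones meet, so that their
    centres form a fast sequence, whose limit is that of the filter. *)
Lemma cauchy_cvg_fast (R : realType) (V : normedModType R) :
  (forall u : nat -> V, (forall n, `|u n.+1 - u n| <= 2^-1 ^+ n) ->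
    exists l, `|u n - l| @[n --> \oo] --> 0) ->
  forall F : set_system V, ProperFilter F -> cauchy F -> cvg F.
Proof.
move=> hV F FF /cauchyP Fc.
have e0 n : 0 < 2^-1 ^+ n.+2 :> R by rewrite exprn_gt0.
have [x xF] := choice (fun n => Fc _ (e0 n)).
have [|l xl] := hV x.
  move=> n; have [y [yn ynS]] := filter_ex (filterI (xF n) (xF n.+1)).
  rewrite -ball_normE /= in yn; rewrite -ball_normE /= in ynS.
  have := ler_distD y (x n.+1) (x n); rewrite [`|y - _|]distrC.
  have : 2^-1 ^+ n.+2 + 2^-1 ^+ n.+3 <= 2^-1 ^+ n :> R.
    have : 0 <= 2^-1 ^+ n :> R by rewrite exprn_ge0.
    by rewrite !exprS; set a : R := _ ^+ n; lra.
  by lra.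
apply/cvg_ex; exists l; apply/cvgrPdist_lt => e e_gt0.
have e2 : 0 < e / 2 by rewrite divr_gt0.
have /cvgr0Pnorm_lt/(_ _ e2) := xl.
move=> /(filterI (near_expr_lt e2))/filter_ex[n [en]].
rewrite normr_id => xnl.
apply: filterS (xF n) => y; rewrite -ball_normE /= => yn.
have := ler_distD (x n) l y; rewrite (distrC l (x n)).
have : 2^-1 ^+ n.+2 <= 2^-1 ^+ n :> R.
  have : 0 <= 2^-1 ^+ n :> R by rewrite exprn_ge0.
  by rewrite !exprS; set a : R := _ ^+ n; lra.
by lra.
Qed.

Section Quotient.
Context {R : realType} (P : cslat R).
Local Notation V := (cs_car P).
Local Notation j := (@cs_join _ P).
Local Notation D := (@cs_dom _ P).
Local Notation N := (@cs_norm _ P).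
Let H : seminormed_lattice j D N := cs_sl P.
Let Hv : vlattice j := sl_vl H.
Implicit Types (v w : V).

(* The choice operator returns the same representative for the whole class. *)
Definition canon w : V := xget 0 [set v | D v /\ N (v - w) = 0].

Let canonP w : D w -> D (canon w) /\ N (canon w - w) = 0.
Proof.
move=> Dw; rewrite /canon; case: xgetP => [v -> []//|/(_ w) []].
by split=> //; rewrite subrr (sl_N0 H).
Qed.

Let canon_eq v w : D v -> D w -> N (v - w) = 0 -> canon v = canon w.
Proof.
move=> Dv Dw vw; rewrite /canon; congr xget; apply/seteqP.
have sub x a b : D a -> D b -> N (a - b) = 0 ->
    D x /\ N (x - a) = 0 -> D x /\ N (x - b) = 0.
  move=> Da Db ab [Dx xa]; split=> //; apply/le_anti; rewrite (sl_N_ge0 H)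
    ?andbT; last exact: (sl_DB H).
  by rewrite (le_trans (sl_Ntri H Dx Da Db))// xa ab addr0.
by split=> x /=; apply: sub => //; rewrite (sl_NB H).
Qed.

(** A subtype of representatives, so that equality and choice are inherited from [V]. *)
Record quot := Quot { qval : V ; quotP : `[< D qval /\ canon qval = qval >] }.

HB.instance Definition _ := [isSub for qval].
HB.instance Definition _ := [Choice of quot by <:].

Lemma quot0_proof : `[< D (canon 0) /\ canon (canon 0) = canon 0 >].
Proof.
have [D0 N0] := canonP (sl_D0 H); apply/asboolP; split=> //.
by apply: canon_eq => //; exact: sl_D0 H.
Qed.

(** The fallback [canon 0] is never taken for [w] in the domain. *)
Definition cls w : quot := insubd (Quot quot0_proof) (canon w).

Lemma qval_dom (q : quot) : D (qval q).
Proof. by case: q => v /= /asboolP[]. Qed.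

Lemma qval_cls w : D w -> N (qval (cls w) - w) = 0.
Proof.
move=> Dw; have [Dc Nc] := canonP Dw.
have h : `[< D (canon w) /\ canon (canon w) = canon w >].
  by apply/asboolP; split=> //; exact: canon_eq.
by rewrite /cls -[qval _]/(val (insubd _ _)) val_insubd h.
Qed.

Lemma cls_eqP v w : D v -> D w -> (cls v = cls w <-> N (v - w) = 0).
Proof.
move=> Dv Dw; split=> [vw|vw]; last by rewrite /cls (canon_eq Dv Dw vw).
apply/le_anti; rewrite (sl_N_ge0 H) ?andbT; last exact: (sl_DB H).
have Dc := qval_dom (cls v).
rewrite (le_trans (sl_Ntri H Dv Dc Dw))// (sl_NB H)// qval_cls// vw.
by rewrite qval_cls// addr0.
Qed.

Lemma qvalK (q : quot) : cls (qval q) = q.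
Proof.
apply: val_inj; rewrite /= /cls -[qval (insubd _ _)]/(val (insubd _ _)).
by case: q => v /= /[dup] vP /asboolP[Dv cv]; rewrite val_insubd cv vP.
Qed.

Lemma clsW (q : quot) : exists2 w, D w & q = cls w.
Proof. by exists (qval q); rewrite ?qvalK//; exact: qval_dom. Qed.

Definition qadd (p q : quot) : quot := cls (qval p + qval q).
Definition qopp (p : quot) : quot := cls (- qval p).
Definition qscale (a : R) (p : quot) : quot := cls (a *: qval p).
Definition qjoin (p q : quot) : quot := cls (j (qval p) (qval q)).
Definition qnorm (p : quot) : R := N (qval p).

Let N0_le v (e : R) : D v -> N v <= e -> e = 0 -> N v = 0.
Proof.
by move=> Dv ve e0; apply/le_anti; rewrite (sl_N_ge0 H)// -e0 ve.
Qed.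

Let clsD v w : D v -> D w -> qadd (cls v) (cls w) = cls (v + w).
Proof.
move=> Dv Dw; have D1 := qval_dom (cls v); have D2 := qval_dom (cls w).
have D3 := sl_DB H D1 Dv; have D4 := sl_DB H D2 Dw.
apply/cls_eqP; [exact: sl_DD H _ _ _ _|exact: sl_DD H _ _ _ _|].
rewrite opprD addrACA; apply: N0_le (sl_ND H D3 D4) _.
  exact: sl_DD H _ _ _ _.
by rewrite !qval_cls// addr0.
Qed.

Let clsZ a v : D v -> qscale a (cls v) = cls (a *: v).
Proof.
move=> Dv; have D1 := qval_dom (cls v); have D3 := sl_DB H D1 Dv.
apply/cls_eqP; [exact: sl_DZ H _ _ _|exact: sl_DZ H _ _ _|].
by rewrite -scalerBr (sl_NZ H)// qval_cls// mulr0.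
Qed.

Let clsN v : D v -> qopp (cls v) = cls (- v).
Proof.
move=> Dv; have := clsZ (-1) Dv.
by rewrite /qscale /qopp !scaleN1r.
Qed.

Let cls_join v w : D v -> D w -> qjoin (cls v) (cls w) = cls (j v w).
Proof.
move=> Dv Dw; have D1 := qval_dom (cls v); have D2 := qval_dom (cls w).
have D3 := sl_Dj H D1 D2; have D4 := sl_Dj H Dv Dw.
apply/cls_eqP => //; apply: N0_le (sl_Njoin H D1 D2 Dv Dw) _.
  exact: sl_DB H _ _ _ _.
by rewrite !qval_cls// addr0.
Qed.

Let cls_norm v : D v -> qnorm (cls v) = N v.
Proof.
move=> Dv; have D1 := qval_dom (cls v); have := sl_Ndist H D1 Dv.
by rewrite qval_cls// normr_le0 subr_eq0 => /eqP.
Qed.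

Let DD := sl_DD H.
Let DN := sl_DN H.
Let DZ := sl_DZ H.
Let Dj := sl_Dj H.
Let D0 := sl_D0 H.

Let qaddA : associative qadd.
Proof.
move=> p q r; have [[u ? ->] [v ? ->] [w ? ->]] := And3 (clsW p) (clsW q) (clsW r).
by rewrite !clsD ?addrA//; exact: DD.
Qed.

Let qaddC : commutative qadd.
Proof. by move=> p q; rewrite /qadd addrC. Qed.

Let qadd0 : left_id (cls 0) qadd.
Proof. by move=> p; have [u ? ->] := clsW p; rewrite clsD// add0r. Qed.

Let qaddN : left_inverse (cls 0) qopp qadd.
Proof.
by move=> p; have [u ? ->] := clsW p; rewrite clsN// clsD ?addNr//; exact: DN.
Qed.

HB.instance Definition _ := GRing.isZmodule.Build quot qaddA qaddC qadd0 qaddN.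

Lemma cls_add v w : D v -> D w -> cls v + cls w = cls (v + w).
Proof. exact: clsD. Qed.

Let qscaleA a b p : qscale a (qscale b p) = qscale (a * b) p.
Proof.
by have [u ? ->] := clsW p; rewrite !clsZ ?scalerA//; exact: DZ.
Qed.

Let qscale1 : left_id 1 qscale.
Proof. by move=> p; rewrite /qscale scale1r qvalK. Qed.

Let qscaleDr : right_distributive qscale +%R.
Proof.
move=> a p q; have [u ? ->] := clsW p; have [v ? ->] := clsW q.
rewrite (cls_add (v := u) (w := v))// (clsZ a (v := u + v)) ?(clsZ a (v := u))//
  ?(clsZ a (v := v))//; last exact: DD.
by rewrite scalerDr cls_add//; exact: DZ.
Qed.

Let qscaleDl p : {morph qscale^~ p : a b / a + b}.
Proof.
move=> a b; have [u ? ->] := clsW p.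
by rewrite /= !clsZ// cls_add ?scalerDl//; exact: DZ.
Qed.

HB.instance Definition _ := GRing.Zmodule_isLmodule.Build R quot
  qscaleA qscale1 qscaleDr qscaleDl.

Lemma cls_scale (a : R) v : D v -> a *: cls v = cls (a *: v).
Proof. exact: clsZ. Qed.

Lemma clsB v w : D v -> D w -> cls v - cls w = cls (v - w).
Proof.
move=> Dv Dw.
by rewrite -[- _]/(qopp _) clsN// cls_add//; exact: DN.
Qed.

Let qnormD p q : qnorm (p + q) <= qnorm p + qnorm q.
Proof.
have [[u ? ->] [v ? ->]] := conj (clsW p) (clsW q).
by rewrite cls_add// !cls_norm//; [exact: sl_ND H _ _ _ _|exact: DD].
Qed.

Let qnormZ (a : R) p : qnorm (a *: p) = `|a| * qnorm p.
Proof.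
have [u ? ->] := clsW p; rewrite cls_scale// !cls_norm//.
  exact: sl_NZ H _ _ _.
exact: DZ.
Qed.

Let qnorm0 p : qnorm p = 0 -> p = 0.
Proof.
have [u Du ->] := clsW p; rewrite cls_norm// => u0.
by rewrite -[0]/(cls 0); apply/cls_eqP => //; rewrite subr0.
Qed.

HB.instance Definition _ := Lmodule_isNormed.Build R quot qnormD qnormZ qnorm0.

Lemma norm_cls v : D v -> `|cls v| = N v.
Proof. exact: cls_norm. Qed.

Let quot_complete (F : set_system quot) : ProperFilter F -> cauchy F -> cvg F.
Proof.
apply: cauchy_cvg_fast => u hu.
have Du n : D (qval (u n)) by exact: qval_dom.
have [|l Dl ul] := @cs_complete _ P (fun n => qval (u n)) Du.
  move=> n; apply: le_trans (hu n).
  by rewrite -{2}(qvalK (u n)) -{2}(qvalK (u n.+1)) clsB// norm_cls//; exact: sl_DB H _ _ _ _.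
exists (cls l); have -> // : (fun n => `|u n - cls l|) = (fun n => N (qval (u n) - l)).
apply/funext => n; rewrite -{1}(qvalK (u n)) clsB// norm_cls//.
exact: sl_DB H _ _ _ _.
Qed.

HB.instance Definition _ := Uniform_isComplete.Build quot quot_complete.

Let qle : rel quot := fun p q => qjoin p q == q.
Let qmeet (p q : quot) := p + q - qjoin p q.

Let qvl : vlattice qjoin.
Proof.
split.
- by move=> p; rewrite /qjoin (vl_idem Hv) qvalK.
- by move=> p q; rewrite /qjoin (vl_joinC Hv).
- move=> p q r; have [[u ? ->] [v ? ->] [w ? ->]] := And3 (clsW p) (clsW q) (clsW r).
  by rewrite !cls_join ?(vl_joinA Hv)//; exact: Dj.
- move=> p q r; have [[u ? ->] [v ? ->] [w ? ->]] := And3 (clsW p) (clsW q) (clsW r).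
  rewrite (cls_add (v := u) (w := w))// (cls_add (v := v) (w := w))//.
  rewrite !cls_join//; [|exact: DD|exact: DD].
  by rewrite cls_add ?(vl_joinD Hv)//; exact: Dj.
- move=> a p q a0; have [[u ? ->] [v ? ->]] := conj (clsW p) (clsW q).
  rewrite (cls_scale a (v := u))// (cls_scale a (v := v))//.
  rewrite !cls_join//; [|exact: DZ|exact: DZ].
  by rewrite cls_scale ?(vl_joinZ Hv)//; exact: Dj.
Qed.

Let qle_refl : reflexive qle. Proof. by move=> p; apply/eqP/(vle_refl qvl). Qed.

Let qle_anti : antisymmetric qle.
Proof. by move=> p q /andP[/eqP pq /eqP qp]; exact: (vle_anti qvl). Qed.

Let qle_trans : transitive qle.
Proof. by move=> p q r /eqP qp /eqP pr; apply/eqP; exact: (vle_trans qvl qp pr). Qed.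

Let qleUx p q r : qle (qjoin p q) r = qle p r && qle q r.
Proof.
apply/eqP/andP => [h|[/eqP h1 /eqP h2]]; last exact: (vleUx qvl).
split; apply/eqP; apply: (vle_trans qvl) h; [exact: (vleUl qvl)|exact: (vleUr qvl)].
Qed.

Let qlexI p q r : qle p (qmeet q r) = qle p q && qle p r.
Proof.
apply/eqP/andP => [h|[/eqP h1 /eqP h2]]; last exact: (vlexI qvl).
split; apply/eqP; apply: (vle_trans qvl) h _; [exact: (vleIl qvl)|exact: (vleIr qvl)].
Qed.

Let qleD2r p q r : qle p q -> qle (p + r) (q + r).
Proof. by move=> /eqP h; apply/eqP/(vleD2r qvl). Qed.

Let qscale_ge0 (a : R) p : 0 <= a -> qle 0 p -> qle 0 (a *: p).
Proof. by move=> a0 /eqP h; apply/eqP/(vle0Z qvl). Qed.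

Let qle_norm p q : qle (qjoin p (- p)) (qjoin q (- q)) -> `|p| <= `|q|.
Proof.
move=> /eqP; have [[u Du ->] [v Dv ->]] := conj (clsW p) (clsW q).
have Du' := sl_Dabs H Du; have Dv' := sl_Dabs H Dv.
rewrite -![- _]/(qopp _) !clsN//.
rewrite (cls_join (v := u))//; last exact: DN.
rewrite (cls_join (v := v))//; last exact: DN.
rewrite (cls_join (v := vabs j u))// => h.
rewrite !norm_cls// -(sl_Nabs H Du) -(sl_Nabs H Dv) -(norm_cls Dv') -h norm_cls.
  apply: (sl_Nle_pos H) => //; first exact: Dj.
    exact: (vabs_ge0 Hv).
  exact: (vleUl Hv).
exact: Dj.
Qed.

HB.instance Definition _ := isBanachLattice.Build R quot
  qle_refl qle_anti qle_trans qleUx qlexI qleD2r qscale_ge0 qle_norm.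

Lemma cls_lin (a : R) v w : D v -> D w ->
  cls (a *: v + w) = a *: cls v + cls w.
Proof.
move=> Dv Dw; by rewrite cls_scale// cls_add//; exact: DZ.
Qed.

Lemma cls_lat_join v w : D v -> D w -> cls (j v w) = lat_join (cls v) (cls w).
Proof. by move=> Dv Dw; rewrite -[lat_join _ _]/(qjoin _ _) cls_join. Qed.

End Quotient.

Definition quotBL (R : realType) (P : cslat R) : banachLatticeType R := quot P.

(** * Completion *)

Lemma fun_vlattice (T : Type) (R : realType) (V : lmodType R)
    (j : V -> V -> V) : vlattice j ->
  vlattice (fun (f g : T -> V) t => j (f t) (g t)).
Proof.
move=> H; split=> [f|f g|f g h|f g h|a f g a0]; apply/funext => t.
- exact: (vl_idem H).
- exact: (vl_joinC H).
- exact: (vl_joinA H).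
- exact: (vl_joinD H).
- exact: (vl_joinZ H).
Qed.

Lemma real_cauchy_cvg (R : realType) (a : nat -> R) :
  (forall e, 0 < e -> exists m, forall i k, (m <= i)%N -> (m <= k)%N ->
    `|a i - a k| < e) -> cvgn a.
Proof.
move=> ha; apply: R_complete; apply/cauchyP => e /ha[m hm].
exists (a m); exists m => // k /= mk.
by rewrite -ball_normE /=; exact: hm.
Qed.

Section Completion.
Context {R : realType} {V : lmodType R} {j : V -> V -> V} {D : set V}.
Context {N : V -> R}.
Hypothesis H : seminormed_lattice j D N.
Implicit Types (s t : nat -> V).

Definition cauchy_dom : set (nat -> V) := [set s | (forall n, D (s n)) /\
  forall e, 0 < e -> exists m, forall i k, (m <= i)%N -> (m <= k)%N ->
    N (s i - s k) < e].

Definition cauchy_join s t : nat -> V := fun n => j (s n) (t n).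

(** This seminorm annihilates both the null sequences and the constants taken in the kernel of [N],
    so that a single quotient separates and completes. *)
Definition cauchy_norm s : R := lim (N (s n) @[n --> \oo]).

Lemma cauchy_normP s : cauchy_dom s -> N (s n) @[n --> \oo] --> cauchy_norm s.
Proof.
move=> [Ds sc]; apply: real_cauchy_cvg => e /sc[m hm]; exists m => i k mi mk.
by apply: le_lt_trans (hm _ _ mi mk); exact: (sl_Ndist H).
Qed.

Lemma cauchy_norm_uniq s l : N (s n) @[n --> \oo] --> l -> cauchy_norm s = l.
Proof. exact: cvg_lim. Qed.

Lemma cauchy_dom_le s : (forall n, D (s n)) ->
  forall t u, cauchy_dom t -> cauchy_dom u -> forall c : R,
  (forall i k, N (s i - s k) <= c * N (t i - t k) + N (u i - u k)) ->
  cauchy_dom s.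
Proof.
move=> Ds t u [Dt tc] [Du uc] c hs; split=> // e e0.
(* Adding 1 keeps the divisor positive when [c = 0]. *)
have c1 : 0 < `|c| + 1 by rewrite ltr_wpDl.
have e1 : 0 < e / 2 / (`|c| + 1) by rewrite !divr_gt0.
have e2 : 0 < e / 2 by rewrite divr_gt0.
have [m hm] := tc _ e1; have [m' hm'] := uc _ e2.
exists (maxn m m') => i k; rewrite !geq_max => /andP[mi m'i] /andP[mk m'k].
apply: le_lt_trans (hs i k) _; rewrite [ltRHS]splitr.
apply: ler_ltD (hm' _ _ m'i m'k).
have n0 : 0 <= N (t i - t k) by apply: (sl_N_ge0 H); exact: (sl_DB H).
apply: le_trans (_ : (`|c| + 1) * N (t i - t k) <= _).
  by rewrite ler_wpM2r// (le_trans (ler_norm c))// lerDl.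
by rewrite mulrC -ler_pdivlMr// ltW// hm.
Qed.

Lemma cauchy_sl : seminormed_lattice cauchy_join cauchy_dom cauchy_norm.
Proof.
have H0 := sl_N0 H; have Hv := sl_vl H.
have Dlin (a : R) s t : cauchy_dom s -> cauchy_dom t -> cauchy_dom (a *: s + t).
  move=> Ds Dt; apply: (cauchy_dom_le _ Ds Dt (c := `|a|)) => [n|i k].
    exact: sl_Dlin H _ _ _ (Ds.1 n) (Dt.1 n).
  rewrite -(sl_NZ H); last exact: (sl_DB H (Ds.1 i) (Ds.1 k)).
  have -> : (a *: s + t) i - (a *: s + t) k = a *: (s i - s k) + (t i - t k).
    by rewrite scalerBr !fctE; zmod.
  apply: (sl_ND H); last exact: (sl_DB H (Dt.1 i) (Dt.1 k)).
  by apply: (sl_DZ H); exact: (sl_DB H (Ds.1 i) (Ds.1 k)).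
have D0 : cauchy_dom 0.
  split=> [n|e e0]; first exact: sl_D0 H.
  by exists 0%N => i k _ _; rewrite subrr H0.
have DZ (a : R) s : cauchy_dom s -> cauchy_dom (a *: s).
  by move=> Ds; rewrite -[_ *: _]addr0; exact: Dlin.
have DD s t : cauchy_dom s -> cauchy_dom t -> cauchy_dom (s + t).
  by move=> Ds Dt; rewrite -[s]scale1r; exact: Dlin.
split=> //.
- exact: fun_vlattice.
- move=> s t Ds Dt; apply: (cauchy_dom_le _ Ds Dt (c := 1)) => [n|i k].
    exact: sl_Dj H _ _ (Ds.1 n) (Dt.1 n).
  by rewrite mul1r; exact: (sl_Njoin H (Ds.1 _) (Dt.1 _) (Ds.1 _) (Dt.1 _)).
- move=> s t Ds Dt; have st : N (s n) + N (t n) @[n --> \oo] --> cauchy_norm s + cauchy_norm t.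
    by apply: cvgD; exact: cauchy_normP.
  apply: (ler_cvg_to (cauchy_normP (DD _ _ Ds Dt)) st); apply: nearW => n.
  exact: (sl_ND H (Ds.1 n) (Dt.1 n)).
- move=> a s Ds; apply: cauchy_norm_uniq.
  have -> : (fun n => N ((a *: s) n)) = (fun n => `|a| * N (s n)).
    by apply/funext => n; exact: (sl_NZ H a (Ds.1 n)).
  by apply: cvgMr; exact: cauchy_normP.
- move=> s t Ds Dt st; apply: (ler_cvg_to (cauchy_normP Ds) (cauchy_normP Dt)).
  apply: nearW => n; apply: (sl_Nle H (Ds.1 n) (Dt.1 n)).
  by rewrite /vle; exact: (congr1 (@^~ n) st).
Qed.

(** Diagonal argument: beyond the index [m n] the sequence [u n] oscillates by less than
    [2^-1 ^+ n], and the limit is [n |-> u n (m n)]. *)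
Lemma cauchy_complete (u : nat -> nat -> V) : (forall n, cauchy_dom (u n)) ->
  (forall n, cauchy_norm (u n.+1 - u n) <= 2^-1 ^+ n) ->
  exists2 l, cauchy_dom l & cauchy_norm (u n - l) @[n --> \oo] --> 0.
Proof.
move=> Du hu; have e0 n : 0 < 2^-1 ^+ n :> R by rewrite exprn_gt0.
have [m hm] := choice (fun n => (Du n).2 _ (e0 n)).
have D1 n i : D (u n i) := (Du n).1 i.
pose t n := u n (m n).
(* Through an index [k] beyond [m n] and [m n.+1]: in units of [2^-1 ^+ n], the two oscillations
   contribute 1 and 1/2, the increment less than 2. *)
have tS n : N (t n - t n.+1) <= 4 * 2^-1 ^+ n.
  have /cauchy_normP uc := sl_DB cauchy_sl (Du n.+1) (Du n).
  have h2 : cauchy_norm (u n.+1 - u n) < 2 * 2^-1 ^+ n.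
    by apply: le_lt_trans (hu n) _; have := e0 n; lra.
  have [k [/= [mk mk'] kn]] : exists k, ((m n <= k)%N /\ (m n.+1 <= k)%N) /\
      N ((u n.+1 - u n) k) < 2 * 2^-1 ^+ n.
    have F1 : \forall k \near \oo, N ((u n.+1 - u n) k) < 2 * 2^-1 ^+ n.
      exact: (cvgr_lt _ uc _ h2).
    have F2 : \forall k \near \oo, (m n <= k)%N by exact: nbhs_infty_ge.
    have F3 : \forall k \near \oo, (m n.+1 <= k)%N by exact: nbhs_infty_ge.
    exact: filter_ex (filterI (filterI F2 F3) F1).
  have a1 := hm n _ _ (leqnn _) mk; have a2 := hm n.+1 _ _ mk' (leqnn _).
  have b1 := sl_Ntri H (D1 n (m n)) (D1 n k) (D1 n.+1 (m n.+1)).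
  have b2 := sl_Ntri H (D1 n k) (D1 n.+1 k) (D1 n.+1 (m n.+1)).
  rewrite (sl_NB H (D1 n k) (D1 n.+1 k)) in b2.
  have : 2^-1 ^+ n.+1 = 2^-1 * 2^-1 ^+ n :> R by rewrite exprS.
  rewrite /t; move: a1 a2 b1 b2 kn; rewrite !fctE; have := e0 n.
  by set x : R := 2^-1 ^+ n; set y : R := 2^-1 ^+ n.+1; lra.
(* The geometric sum of the bounds [4 * 2^-1 ^+ k] for [n <= k < n + d]. *)
have tl n d : N (t n - t (n + d)%N) <= 8 * (2^-1 ^+ n - 2^-1 ^+ (n + d)%N).
  elim: d => [|d IH]; first by rewrite addn0 !subrr (sl_N0 H) mulr0.
  have Dt k : D (t k) by exact: D1.
  rewrite addnS; apply: le_trans (sl_Ntri H (Dt n) (Dt (n + d)%N) (Dt _)) _.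
  apply: le_trans (lerD IH (tS _)) _; rewrite exprS.
  by set x : R := 2^-1 ^+ n; set y : R := 2^-1 ^+ (n + d); lra.
have tle n k : (n <= k)%N -> N (t n - t k) <= 8 * 2^-1 ^+ n.
  move=> nk; rewrite -(subnKC nk); apply: le_trans (tl _ _) _.
  by rewrite ler_pM2l// gerBl// ltW.
have Dt : cauchy_dom t.
  split=> [k|e ep]; first exact: D1.
  (* Both [t i] and [t k] are within [8 * 2^-1 ^+ n] of [t n]. *)
  have e16 : 0 < e / 16 by rewrite divr_gt0.
  have [n /= en] := filter_ex (near_expr_lt e16).
  exists n => i k ni nk.
  apply: le_lt_trans (sl_Ntri H (D1 _ _) (D1 n (m n)) (D1 _ _)) _.
  rewrite (sl_NB H)//; have := tle _ _ ni; have := tle _ _ nk.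
  by rewrite -/(t n) -/(t i) -/(t k) => h1 h2; lra.
exists t => //; apply/cvgr0Pnorm_lt => e ep.
have e16 : 0 < e / 16 by rewrite divr_gt0.
apply: filterS (near_expr_lt e16) => n en.
have Dn := sl_DB cauchy_sl (Du n) Dt.
rewrite ger0_norm; last exact: sl_N_ge0 cauchy_sl _ Dn.
(* One unit is the oscillation of [u n] beyond [m n], the other eight are the distance from [t n] to
   [t i]. *)
have : cauchy_norm (u n - t) <= 9 * 2^-1 ^+ n.
  apply: (limr_le (cauchy_normP Dn)).
  near=> i.
  have ni : (n <= i)%N by near: i; exact: nbhs_infty_ge.
  have mi : (m n <= i)%N by near: i; exact: nbhs_infty_ge.
  have := sl_Ntri H (D1 n i) (D1 n (m n)) (D1 i (m i)).
  have := hm n _ _ mi (leqnn _); have := tle _ _ ni.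
  rewrite /t !fctE; set x : R := 2^-1 ^+ n; lra.
by lra.
Unshelve. all: by end_near. Qed.

End Completion.

(** [i] annihilates the kernel of [N], so it need not be injective; its values outside [D] are
    arbitrary. *)
Record completion_of (R : realType) (V : lmodType R) (j : V -> V -> V)
    (D : set V) (N : V -> R) (S : banachLatticeType R) (i : V -> S) : Prop :=
  CompletionOf {
  cpl_norm : forall v, D v -> `|i v| = N v ;
  cpl_lin : forall (a : R) v w, D v -> D w -> i (a *: v + w) = a *: i v + i w ;
  cpl_join : forall v w, D v -> D w -> i (j v w) = lat_join (i v) (i w) ;
  cpl_dense : forall s (e : R), 0 < e -> exists2 v, D v & `|s - i v| < e
}.

Lemma completion_exists (R : realType) (V : lmodType R) (j : V -> V -> V)
    (D : set V) (N : V -> R) : seminormed_lattice j D N ->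
  exists (S : banachLatticeType R) (i : V -> S), completion_of j D N i.
Proof.
move=> H; pose P : cslat R := CSLat (cauchy_sl H) (cauchy_complete H).
exists (quotBL P), (fun v => @cls R P (fun=> v)).
have cst_dom v : D v -> cauchy_dom (D := D) (N := N) (fun=> v).
  by move=> Dv; split=> // e e0; exists 0%N => *; rewrite subrr (sl_N0 H).
split=> [v Dv|a v w Dv Dw|v w Dv Dw|q e e0].
- rewrite norm_cls; last exact: cst_dom.
  by apply: cauchy_norm_uniq; exact: cvg_cst.
- by rewrite -cls_lin//; exact: cst_dom.
- by rewrite -cls_lat_join//; exact: cst_dom.
- have [s Ds ->] := clsW q; have [m hm] := Ds.2 _ (divr_gt0 e0 (ltr0n _ 2)).
  exists (s m); first exact: Ds.1.
  have Dm := cst_dom _ (Ds.1 m); have DB := sl_DB (cauchy_sl H) Ds Dm.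
  rewrite clsB// norm_cls//.
  apply: (@le_lt_trans _ _ (e / 2)); last by rewrite ltr_pdivrMr// ltr_pMr// ltr1n.
  apply: (limr_le (cauchy_normP H DB)); exists m => // k /= mk.
  by apply/ltW; exact: hm.
Qed.

Section CompletionTheory.
Context {R : realType} {V : lmodType R} {j : V -> V -> V} {D : set V}.
Context {N : V -> R} {S : banachLatticeType R} {i : V -> S}.
Hypothesis (H : seminormed_lattice j D N) (cS : completion_of j D N i).

Lemma cplD v w : D v -> D w -> i (v + w) = i v + i w.
Proof. by move=> Dv Dw; rewrite -[v in LHS]scale1r (cpl_lin cS)// scale1r. Qed.

Lemma cplB v w : D v -> D w -> i (v - w) = i v - i w.
Proof.
by move=> Dv Dw; rewrite addrC -scaleN1r (cpl_lin cS)// scaleN1r addrC.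
Qed.

Lemma cpl0 : i 0 = 0.
Proof. by rewrite -[X in i X](subrr 0) cplB ?subrr//; exact: sl_D0 H. Qed.

End CompletionTheory.

(** * Extension through universal disposition *)

Lemma separableP (R : realType) (V : normedModType R) :
  separable V <-> exists2 D : set V, countable D &
    forall x (e : R), 0 < e -> exists2 d, D d & `|x - d| < e.
Proof.
split=> -[D cD dD]; exists D => //.
  move=> x e e0; have [||y [xy Dy]] := dD (ball x e).
  - by exists x; exact: ballxx.
  - exact: ball_open.
  - by exists y => //; rewrite -ball_normE in xy.
move=> O [x Ox] oO; have [e /= e0 eO] := (nbhs_ballP _ _).1 (open_nbhs_nbhs (conj oO Ox)).
have [d Dd xd] := dD x _ e0; exists d; split=> //.
by apply: eO; rewrite -ball_normE.
Qed.

Lemma separable_dense_image (R : realType) (V W : normedModType R) (u : V -> W)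
    (M : R) : separable V ->
  (forall x y, `|u x - u y| <= M * `|x - y|) ->
  (forall w (e : R), 0 < e -> exists v, `|w - u v| < e) -> separable W.
Proof.
move=> /separableP[D cD dD] uM ud; apply/separableP; exists (u @` D).
  exact: sub_countable (card_image_le _ _) cD.
move=> w e e0; have e2 : 0 < e / 2 by rewrite divr_gt0.
have [v wv] := ud w _ e2.
have M1 : 0 < `|M| + 1 by rewrite ltr_wpDl.
have e3 : 0 < e / 2 / (`|M| + 1) by rewrite divr_gt0.
have [d Dd vd] := dD v _ e3; exists (u d); first by exists d.
apply: le_lt_trans (ler_distD (u v) w (u d)) _; rewrite [ltRHS]splitr.
apply: ltr_leD => //; apply: le_trans (uM v d) _.
apply: le_trans (_ : (`|M| + 1) * `|v - d| <= _).
  by rewrite ler_wpM2r// (le_trans (ler_norm M))// lerDl.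
by rewrite mulrC -ler_pdivlMr// ltW.
Qed.

Lemma fast_cvg (R : realType) (V : completeNormedModType R) (u : nat -> V) :
  (forall n, `|u n.+1 - u n| <= 2^-1 ^+ n) ->
  exists l, `|u n - l| @[n --> \oo] --> 0.
Proof.
move=> hu.
have ul n d : `|u n - u (n + d)%N| <= 2 * (2^-1 ^+ n - 2^-1 ^+ (n + d)%N).
  elim: d => [|d IH]; first by rewrite addn0 !subrr normr0 mulr0.
  rewrite addnS; apply: le_trans (ler_distD (u (n + d)%N) _ _) _.
  rewrite (distrC (u (n + d)%N)); apply: le_trans (lerD IH (hu _)) _.
  by rewrite exprS; set x : R := 2^-1 ^+ n; set y : R := 2^-1 ^+ (n + d); lra.
have : cvg (u @ \oo).
  apply: cauchy_cvg; apply/cauchyP => e e0.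
  have e2 : 0 < e / 2 by rewrite divr_gt0.
  have [n /= en] := filter_ex (near_expr_lt e2).
  exists (u n); exists n => // k /= nk; rewrite -ball_normE /= -(subnKC nk).
  apply: le_lt_trans (ul _ _) _; rewrite -ltr_pdivlMl// mulrC.
  by apply: le_lt_trans en; rewrite gerBl.
move=> /cvg_ex[l ul']; exists l; apply/cvgr0Pnorm_lt => e e0.
move/cvgrPdist_lt : ul' => /(_ _ e0).
by apply: filterS => n; rewrite distrC normr_id.
Qed.

(** * Embeddings given on a dense subset *)

Section Graph.
Context {R : realType} {Z X : banachLatticeType R}.
Variable G : Z -> X -> Prop.
Hypothesis Glin : forall (a : R) z x z' x', G z x -> G z' x' ->
  G (a *: z + z') (a *: x + x').
Hypothesis Gjoin : forall z x z' x', G z x -> G z' x' ->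
  G (lat_join z z') (lat_join x x').
Hypothesis Gnorm : forall z x, G z x -> `|x| = `|z|.
Hypothesis Gdense : forall z (e : R), 0 < e ->
  exists z' x', G z' x' /\ `|z - z'| < e.

Let GB z x z' x' : G z x -> G z' x' -> `|x - x'| = `|z - z'|.
Proof.
move=> zx zx'; apply: Gnorm.
by have := Glin (-1) zx' zx; rewrite !scaleN1r ![- _ + _]addrC.
Qed.

(** The closure of [G] in the product. Linearity and preservation of the norm make it single-valued,
    completeness of [X] makes it total. *)
Let cl z x := forall e : R, 0 < e ->
  exists z' x', [/\ G z' x', `|z - z'| < e & `|x - x'| < e].

Let clP z x z' x' : cl z x -> cl z' x' -> forall e : R, 0 < e ->
  exists u v u' v', [/\ G u v, G u' v', `|z - u| < e, `|x - v| < e &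
    `|z' - u'| < e /\ `|x' - v'| < e].
Proof.
move=> c c' e e0; have [u [v [? ? ?]]] := c e e0.
by have [u' [v' [? ? ?]]] := c' e e0; exists u, v, u', v'.
Qed.

Let cl_fun z x y : cl z x -> cl z y -> x = y.
Proof.
move=> zx zy; apply/eqP; rewrite -subr_eq0 -normr_le0; apply/ler_addgt0Pr => e e0.
(* Four errors: two approximations of [z], one of [x] and one of [y]. *)
have e4 : 0 < e / 4 by rewrite divr_gt0.
have [u [v [u' [v' [uv uv' zu xv [zu' yv']]]]]] := clP zx zy e4.
have := ler_distD v x y; have := ler_distD v' v y; have := ler_distD z u u'.
rewrite (GB uv uv') (distrC u z) (distrC v' y) add0r; lra.
Qed.

Let cl_tot z : exists x, cl z x.
Proof.
(* Approximations of [z] within [2^-1 ^+ n.+1] have increments below [2^-1 ^+ n]. *)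
have e0 n : 0 < 2^-1 ^+ n.+1 :> R by rewrite exprn_gt0.
have [w wP] := choice (fun n => Gdense z (e0 n)).
have [y yP] := choice wP.
have [|x yx] := fast_cvg (u := y).
  move=> n; have [g1 h1] := yP n; have [g2 h2] := yP n.+1.
  rewrite (GB g2 g1); have := ler_distD z (w n.+1) (w n).
  rewrite (distrC _ z); move: h1 h2; rewrite !exprS.
  by have := e0 n; rewrite exprS; set a : R := 2^-1 ^+ n; lra.
exists x => e ep; have /cvgr0Pnorm_lt/(_ _ ep) := yx.
move=> /(filterI (near_expr_lt ep))/filter_ex[n [en]]; rewrite normr_id => yxn.
have [g1 h1] := yP n; exists (w n), (y n); split=> //; last by rewrite distrC.
apply: lt_trans h1 _; apply: le_lt_trans en.
by rewrite exprS; have := e0 n; rewrite exprS; set a : R := 2^-1 ^+ n; lra.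
Qed.

Let cl_lin (a : R) z x z' x' : cl z x -> cl z' x' ->
  cl (a *: z + z') (a *: x + x').
Proof.
move=> c c' e ep; have a1 : 0 < `|a| + 1 by rewrite ltr_wpDl.
have e1 : 0 < e / (`|a| + 1) by rewrite divr_gt0.
have [u [v [u' [v' [uv uv' zu xv [zu' xv']]]]]] := clP c c' e1.
have h (W : normedModType R) (p q p' q' : W) :
    `|p - q| < e / (`|a| + 1) -> `|p' - q'| < e / (`|a| + 1) ->
    `|a *: p + p' - (a *: q + q')| < e.
  move=> pq pq'; have -> : a *: p + p' - (a *: q + q') = (a *: p - a *: q) + (p' - q').
    by zmod.
  apply: le_lt_trans (ler_normD _ _) _; rewrite -scalerBr normrZ.
  have : e = (`|a| + 1) * (e / (`|a| + 1)) by rewrite mulrC divfK// gt_eqF.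
  rewrite mulrDl mul1r => ->; apply: ler_ltD => //.
  by rewrite ler_wpM2l// ltW.
exists (a *: u + u'), (a *: v + v'); split; [exact: Glin|exact: h|exact: h].
Qed.

Let cl_join z x z' x' : cl z x -> cl z' x' ->
  cl (lat_join z z') (lat_join x x').
Proof.
move=> c c' e ep; have e1 : 0 < e / 2 by rewrite divr_gt0.
have [u [v [u' [v' [uv uv' zu xv [zu' xv']]]]]] := clP c c' e1.
exists (lat_join u u'), (lat_join v v'); split; first exact: Gjoin.
  apply: le_lt_trans (sl_Njoin (norm_seminormed Z) I I I I) _ => /=.
  by rewrite [ltRHS]splitr ltrD.
apply: le_lt_trans (sl_Njoin (norm_seminormed X) I I I I) _ => /=.
by rewrite [ltRHS]splitr ltrD.
Qed.

Let cl_norm z x : cl z x -> `|x| = `|z|.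
Proof.
move=> c; apply/eqP; rewrite -subr_eq0 -normr_le0; apply/ler_addgt0Pr => e ep.
have e2 : 0 < e / 2 by rewrite divr_gt0.
have [u [v [uv zu xv]]] := c _ e2.
have := le_trans (ler_dist_dist x v) (ltW xv).
have := le_trans (ler_dist_dist z u) (ltW zu).
rewrite (Gnorm uv) add0r !ler_norml => /andP[a1 a2] /andP[b1 b2].
by apply/andP; split; lra.
Qed.

Lemma graph_embedding : exists2 h : Z -> X, embedding h &
  forall z x, G z x -> h z = x.
Proof.
have [h hP] := choice cl_tot; exists h; last first.
  move=> z x zx; apply: (cl_fun (hP z)) => e ep.
  by exists z, x; rewrite !subrr !normr0.
split; last by move=> z; exact: cl_norm.
apply: lattice_homP => //.
- by move=> a z z' _ _; exact: (cl_fun (hP _) (cl_lin a (hP z) (hP z'))).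
- by move=> z z' _ _; exact: (cl_fun (hP _) (cl_join (hP z) (hP z'))).
- by exists 1 => z _; rewrite (cl_norm (hP z)) mul1r.
Qed.

End Graph.

Section LatticeHomOn.
Context {R : realType} {Y X : banachLatticeType R} {A : set Y} {T : Y -> X}.
Hypothesis cA : closed_sublattice A.
Hypothesis hT : lattice_hom_on A T.
Implicit Types x y : Y.

Lemma csl0 : A 0. Proof. by case: cA. Qed.
Lemma cslL (a : R) x y : A x -> A y -> A (a *: x + y).
Proof. by case: cA => _ _ + _ _; exact. Qed.
Lemma cslj x y : A x -> A y -> A (lat_join x y).
Proof. by case: cA => _ _ _ + _; exact. Qed.
Lemma cslD x y : A x -> A y -> A (x + y).
Proof. by move=> Ax Ay; rewrite -[x]scale1r; exact: cslL. Qed.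
Lemma cslZ (a : R) x : A x -> A (a *: x).
Proof. by move=> Ax; rewrite -[_ *: _]addr0; apply: cslL => //; exact: csl0. Qed.
Lemma cslN x : A x -> A (- x).
Proof. by move=> Ax; rewrite -scaleN1r; exact: cslZ. Qed.

Lemma lhomL (a : R) x y : A x -> A y -> T (a *: x + y) = a *: T x + T y.
Proof. by case: hT => + _ _ _; exact. Qed.
Lemma lhomj x y : A x -> A y -> T (lat_join x y) = lat_join (T x) (T y).
Proof. by case: hT => _ + _ _; exact. Qed.
Lemma lhom0 : T 0 = 0.
Proof.
have := lhomL (-1) csl0 csl0; rewrite scaler0 addr0 scaleN1r addNr.
by [].
Qed.
Lemma lhomD x y : A x -> A y -> T (x + y) = T x + T y.
Proof. by move=> Ax Ay; rewrite -[x in LHS]scale1r lhomL// scale1r. Qed.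
Lemma lhomZ (a : R) x : A x -> T (a *: x) = a *: T x.
Proof.
by move=> Ax; rewrite -[_ *: x]addr0 lhomL//; [rewrite lhom0 addr0|exact: csl0].
Qed.
Lemma lhomN x : A x -> T (- x) = - T x.
Proof. by move=> Ax; rewrite -scaleN1r lhomZ// scaleN1r. Qed.
Lemma lhom_abs x : A x -> T (vabs lat_join x) = vabs lat_join (T x).
Proof. by move=> Ax; rewrite /vabs lhomj ?lhomN//; exact: cslN. Qed.
Lemma lhom_pos x : A x -> T (vpos lat_join x) = vpos lat_join (T x).
Proof. by move=> Ax; rewrite /vpos lhomj ?lhom0//; exact: csl0. Qed.

Lemma lhom_seminormed : seminormed_lattice (@lat_join R Y) A (fun y => `|T y|).
Proof.
split; [exact: lat_vlattice|exact: csl0|exact: cslL|exact: cslj| | |].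
- by move=> x y Ax Ay; rewrite lhomD//; exact: ler_normD.
- by move=> a x Ax; rewrite lhomZ// normrZ.
- move=> x y Ax Ay xy; apply: norm_vle; rewrite -!lhom_abs// /vle -lhomj.
  + by rewrite xy.
  + by apply: cslj => //; exact: cslN.
  + by apply: cslj => //; exact: cslN.
Qed.

Lemma le_opnorm x : A x -> `|T x| <= opnorm_on A T * `|x|.
Proof.
move=> Ax; case: hT => _ _ _ [M hM].
have [->|x0] := eqVneq x 0; first by rewrite lhom0 !normr0 mulr0.
have nx : 0 < `|x| by rewrite normr_gt0.
rewrite -ler_pdivrMr// mulrC -[_^-1]ger0_norm ?invr_ge0// -normrZ -lhomZ//.
apply: ub_le_sup.
  exists `|M| => _ [y [Ay y1] <-]; apply: le_trans (hM _ Ay) _.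
  apply: le_trans (ler_wpM2r (normr_ge0 y) (ler_norm M)) _.
  by rewrite -[leRHS]mulr1 ler_wpM2l.
exists (`|x|^-1 *: x) => //; split; first exact: cslZ.
by rewrite /= normrZ ger0_norm ?invr_ge0// mulVf// gt_eqF.
Qed.

(** A nonzero vector of [A] gives the sign through [le_opnorm]; if there is none, the supremum is
    taken over [[set 0]]. *)
Lemma opnorm_on_ge0 : 0 <= opnorm_on A T.
Proof.
have [[x [Ax x0]]|nx] := pselect (exists x, A x /\ `|x| != 0).
  have := le_trans (normr_ge0 (T x)) (le_opnorm Ax).
  by rewrite pmulr_lge0// lt_neqAle eq_sym x0 normr_ge0.
suff E : [set `|T x| | x in A `&` [set x | `|x| <= 1]] = [set 0].
  by rewrite /opnorm_on E sup1.
apply/seteqP; split.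
  move=> _ [y [Ay _] <-] /=; case: (eqVneq y 0) => [->|y0].
    by rewrite lhom0 normr0.
  by exfalso; apply: nx; exists y; rewrite normr_eq0.
move=> _ ->; exists 0; last by rewrite lhom0 normr0.
by split; [exact: csl0|rewrite /= normr0].
Qed.

End LatticeHomOn.

Lemma closed_sublatticeT (R : realType) (Y : banachLatticeType R) :
  closed_sublattice [set: Y].
Proof. by split=> //; exact: closedT. Qed.

Section Extension.
Context {R : realType} {Y X S : banachLatticeType R} {A : set Y} {T : Y -> X}.
Variables (C : banachLatticeType R -> Prop) (u : Y -> S).

(* [S] receives [Y] in such a way that the norm of the image of [A] is the one
   induced by [T]: then [T] and [u] induce embeddings of the completion of [A]
   for that norm, and universal disposition applies to these. *)
Lemma extension_through : universal_disposition C X -> C S ->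
  closed_sublattice A -> lattice_hom_on A T -> lattice_hom u ->
  (forall a, A a -> `|u a| = `|T a|) ->
  (forall y, `|u y| <= opnorm_on A T * `|y|) ->
  exists T' : Y -> X,
    [/\ lattice_hom T', forall x, A x -> T' x = T x &
        opnorm T' <= 1 * opnorm_on A T].
Proof.
move=> XC CS cA hT hu uT uM.
have sA := lhom_seminormed cA hT; have [E [i cE]] := completion_exists sA.
have cY := closed_sublatticeT Y.
(* Used for [u] on all of [Y] and for [T] on [A]: both induce on [A] the seminorm of which [E] is
   the completion. *)
have emb (W : banachLatticeType R) (B : set Y) (v : Y -> W) :
    A `<=` B -> closed_sublattice B -> lattice_hom_on B v ->
    (forall a, A a -> `|v a| = `|T a|) ->
    exists2 h : E -> W, embedding h & forall a, A a -> h (i a) = v a.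
  move=> AB cB hv vT.
  pose G (z : E) (w : W) := exists a, [/\ A a, z = i a & w = v a].
  have [||||h h1 h2] := @graph_embedding R E W G.
  - move=> a _ _ _ _ [x [Ax -> ->]] [x' [Ax' -> ->]].
    exists (a *: x + x'); split; first exact: (cslL cA).
      by rewrite (cpl_lin cE).
    by rewrite (lhomL hv)//; exact: AB.
  - move=> _ _ _ _ [x [Ax -> ->]] [x' [Ax' -> ->]].
    exists (lat_join x x'); split; first exact: (cslj cA).
      by rewrite (cpl_join cE).
    by rewrite (lhomj hv)//; exact: AB.
  - by move=> _ _ [x [Ax -> ->]]; rewrite (cpl_norm cE)// vT.
  - move=> z e e0; have [x Ax zx] := cpl_dense cE z e0.
    by exists (i x), (v x); split=> //; exists x.
  exists h => // a Aa; apply: h2; by exists a.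
have [f ef fu] := emb S setT u (@subsetT _ A) cY hu uT.
have [g eg gT] := emb X A T (@subset_refl _ A) cA hT (fun _ _ => erefl).
have [h [hh hn] hfg] := XC E S f g CS ef eg.
have T'M y : `|h (u y)| <= opnorm_on A T * `|y| by rewrite hn.
exists (h \o u); split.
- apply: lattice_homP => //=.
  + by move=> a x y _ _; rewrite (lhomL hu)// (lhomL hh).
  + by move=> x y _ _; rewrite (lhomj hu)// (lhomj hh).
  + by exists (opnorm_on A T) => y _; exact: T'M.
- move=> x Ax /=; rewrite -fu// -gT//; exact: (congr1 (@^~ (i x)) hfg).
- rewrite mul1r; apply: ge_sup.
    by exists `|h (u 0)|, 0 => //; split=> //=; rewrite normr0.
  move=> _ [y [_ y1] <-]; apply: le_trans (T'M y) _.
  by rewrite -[leRHS]mulr1 ler_wpM2l//; exact: opnorm_on_ge0 cA hT.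
Qed.

End Extension.

Section SeminormCompletion.
Context {R : realType} {Y S : banachLatticeType R} {q : Y -> R} {M : R}.
Context {i : Y -> S}.
Hypothesis cS : completion_of lat_join setT q i.
Hypothesis qM : forall y, q y <= M * `|y|.

Lemma cpl_hom : lattice_hom i.
Proof.
apply: lattice_homP => //.
- by move=> a x y _ _; rewrite (cpl_lin cS).
- by move=> x y _ _; rewrite (cpl_join cS).
- by exists M => x _; rewrite (cpl_norm cS).
Qed.

Lemma separable_completion : separable Y -> separable S.
Proof.
move=> sY; apply: (separable_dense_image (u := i) (M := M)) sY _ _.
  by move=> x y; rewrite -(cplB cS)// (cpl_norm cS).
by move=> w e e0; have [v _ wv] := cpl_dense cS w e0; exists v.
Qed.

End SeminormCompletion.

(** * The seminorm of part (i) *)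

Section InfConvolution.
Context {R : realType} {Y X : banachLatticeType R} {A : set Y} {T : Y -> X}.
Hypothesis cA : closed_sublattice A.
Hypothesis hT : lattice_hom_on A T.
Local Notation vle := (vle (@lat_join R Y)).
Local Notation vabs := (vabs (@lat_join R Y)).
Let M := opnorm_on A T.
Let Hv : vlattice (@lat_join R Y) := lat_vlattice.
Let sA := lhom_seminormed cA hT.
Let sY := norm_seminormed Y.
Implicit Types x y a b : Y.

(* The largest lattice seminorm on [Y] below [M * `|y|] and, on [A], below
   [`|T a|]. *)
Definition dom_values y : set R := [set r | exists a b,
  [/\ A a, vle 0 a, vle 0 b, vle (vabs y) (a + b) & r = `|T a| + M * `|b|]].

Definition infconv y : R := inf (dom_values y).

Let M0 : 0 <= M := opnorm_on_ge0 cA hT.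

Let dom_ge0 y r : dom_values y r -> 0 <= r.
Proof. by move=> [a [b [_ _ _ _ ->]]]; rewrite addr_ge0// mulr_ge0. Qed.

Let dom_norm y : dom_values y (M * `|y|).
Proof.
exists 0, (vabs y); split; [exact: (csl0 cA)|exact: (vle_refl Hv)| | |].
- exact: (vabs_ge0 Hv).
- by rewrite add0r; exact: (vle_refl Hv).
- by rewrite (lhom0 cA hT) normr0 add0r (sl_Nabs sY).
Qed.

Let dom_has_inf y : has_inf (dom_values y).
Proof.
split; first by exists (M * `|y|); exact: dom_norm.
by exists 0 => r /dom_ge0.
Qed.

Let infconv_le y r : dom_values y r -> infconv y <= r.
Proof. by apply: ge_inf; exists 0 => s /dom_ge0. Qed.

Let le_infconv y s : (forall r, dom_values y r -> s <= r) -> s <= infconv y.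
Proof. by move=> h; apply: lb_le_inf => //; have [] := dom_has_inf y. Qed.

Lemma infconv_le_norm y : infconv y <= M * `|y|.
Proof. exact: infconv_le (dom_norm y). Qed.

(** For the lower bound, let [vabs a] be below [x + b]. The element [c = vpos (vabs a - x)] belongs
    to the sublattice and lies below [b], so that the norm of [T c] is at most [M] times that of
    [b]; and [vabs a] is below [x + c]. *)
Lemma infconv_A a : A a -> infconv a = `|T a|.
Proof.
move=> Aa; apply/le_anti/andP; split.
  apply: infconv_le; exists (vabs a), 0; split.
  - by apply: (cslj cA) => //; exact: (cslN cA).
  - exact: (vabs_ge0 Hv).
  - exact: (vle_refl Hv).
  - by rewrite addr0; exact: (vle_refl Hv).
  - by rewrite (sl_Nabs sA Aa) normr0 mulr0 addr0.
apply: le_infconv => _ [x [b [Ax x0 b0 axb ->]]].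
have Aabs := sl_Dabs sA Aa.
set c := vpos lat_join (vabs a - x).
have Ac : A c by apply: (sl_Dpos sA); exact: (sl_DB sA).
have c0 : vle 0 c by exact: (vpos_ge0 Hv).
have cb : vle c b.
  apply: (vpos_lub Hv) => //; rewrite -[b](addrK x) [b + x]addrC.
  exact: (vleD2r Hv).
apply: le_trans (_ : `|T x| + `|T c| <= _).
  apply: le_trans (sl_ND sA Ax Ac); rewrite -(sl_Nabs sA Aa).
  apply: (sl_Nle_pos sA) => //; [exact: (cslD cA)|exact: (vabs_ge0 Hv)|].
  by rewrite addrC; apply: (vle_addr Hv); exact: (vpos_ge Hv).
rewrite lerD2l; apply: le_trans (le_opnorm cA hT Ac) _.
by rewrite ler_wpM2l//; exact: (sl_Nle_pos sY).
Qed.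

Lemma infconv_seminormed : seminormed_lattice (@lat_join R Y) setT infconv.
Proof.
(* The converse inequality is this one for [a^-1]. *)
have Zle (a : R) y : infconv (a *: y) <= `|a| * infconv y.
  have [->|a0] := eqVneq a 0.
    rewrite scale0r normr0 mul0r; apply: le_trans (infconv_le_norm 0) _.
    by rewrite normr0 mulr0.
  have na : 0 < `|a| by rewrite normr_gt0.
  rewrite mulrC -ler_pdivrMr//; apply: le_infconv => _ [x [b [Ax x0 b0 yxb ->]]].
  rewrite ler_pdivrMr//; apply: infconv_le.
  exists (`|a| *: x), (`|a| *: b); split.
  - exact: (cslZ cA).
  - exact: (vle0Z Hv).
  - exact: (vle0Z Hv).
  - by rewrite (vabsZ Hv) -scalerDr; exact: (vleZ Hv).
  - by rewrite (lhomZ cA hT)// !normrZ !normr_id mulrDl mulrCA; congr (_ + _); ring.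
split=> //.
- move=> x y _ _; rewrite -lerBlDr; apply: le_infconv.
  move=> _ [a [b [Aa a0 b0 xab ->]]]; rewrite lerBlDr -lerBlDl.
  apply: le_infconv => _ [a' [b' [Aa' a0' b0' xab' ->]]]; rewrite lerBlDl.
  apply: le_trans (_ : `|T (a + a')| + M * `|b + b'| <= _).
    apply: infconv_le; exists (a + a'), (b + b'); split=> //.
    + exact: (cslD cA).
    + exact: (vle0D Hv).
    + exact: (vle0D Hv).
    + apply: (vle_trans Hv) (vabsD Hv _ _) _.
      by rewrite addrACA; exact: (vleD Hv).
  rewrite (lhomD hT)//; have := ler_normD (T a) (T a').
  have : M * `|b + b'| <= M * (`|b| + `|b'|) by rewrite ler_wpM2l// ler_normD.
  by rewrite mulrDr; lra.
- move=> a x _; apply/le_anti; rewrite Zle /=.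
  have [->|a0] := eqVneq a 0.
    by rewrite normr0 mul0r; apply: le_infconv => r /dom_ge0.
  have na : 0 < `|a| by rewrite normr_gt0.
  rewrite mulrC -ler_pdivlMr//; have := Zle a^-1 (a *: x).
  by rewrite scalerA mulVf// scale1r normfV mulrC.
- move=> x y _ _ xy; apply: le_infconv => _ [a [b [Aa a0 b0 yab ->]]].
  apply: infconv_le; exists a, b; split=> //.
  exact: (vle_trans Hv xy yab).
Qed.

End InfConvolution.

Lemma universal_disposition_BL_injective (R : realType) (X : banachLatticeType R) :
  universal_disposition (fun S => separable S) X ->
  separably_BL_injective 1%R X.
Proof.
move=> uX Y A T sY cA hT; have sq := infconv_seminormed cA hT.
have qM := infconv_le_norm cA hT.
have [S [i cS]] := completion_exists sq.
apply: (extension_through (u := i) uX) => //.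
- exact: separable_completion cS qM sY.
- exact: cpl_hom cS qM.
- by move=> a Aa; rewrite (cpl_norm cS)//; exact: infconv_A.
- by move=> y; rewrite (cpl_norm cS).
Qed.

(** * AL-spaces *)

(** Zorn's lemma runs over sets of pairs rather than functions: a linear set of pairs dominated by
    [p] is automatically a graph, two values over the same point differing by at most [p 0 = 0]. *)
Lemma hahn_banach (R : realType) (V : lmodType R) (A : set V) (p phi : V -> R) :
  A 0 -> (forall (a : R) x y, A x -> A y -> A (a *: x + y)) ->
  (forall x y, p (x + y) <= p x + p y) ->
  (forall (a : R) x, 0 <= a -> p (a *: x) = a * p x) ->
  (forall (a : R) x y, A x -> A y -> phi (a *: x + y) = a * phi x + phi y) ->
  (forall x, A x -> phi x <= p x) ->
  exists psi : V -> R,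
    [/\ forall (a : R) x y, psi (a *: x + y) = a * psi x + psi y,
        forall x, A x -> psi x = phi x & forall x, psi x <= p x].
Proof.
move=> A0 Alin pD pZ philin phip.
have p0 : p 0 = 0 by rewrite -(scale0r 0) pZ// mul0r.
pose Gam : set (V * R) := [set z | A z.1 /\ z.2 = phi z.1].
pose good (G : set (V * R)) :=
  (forall (a : R) z w, G z -> G w -> G (a *: z.1 + w.1, a * z.2 + w.2)) /\
  (forall z, G z -> z.2 <= p z.1).
have goodG : good Gam.
  split=> [a [x r] [y s]|[x r]].
    move=> [/= Ax ->] [/= Ay ->].
    by split=> /=; [exact: Alin|rewrite philin].
  by move=> [/= Ax ->]; exact: phip.
(* The graph of [phi] is added because the union of the empty chain is empty and must still satisfy
   [P]. *)
pose P G := good (G `|` Gam).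
have [F FP Ftot|G [PG Gmax]] := @Zorn_bigcup _ P.
  split=> [a z w|z].
  - move=> [[X FX Xz]|Gz] [[X' FX' Xw]|Gw].
    + have [XX'|X'X] := Ftot _ _ FX FX'.
        have [h|h] := (FP _ FX').1 a z w (or_introl (XX' _ Xz)) (or_introl Xw).
          by left; exists X'.
        by right.
      have [h|h] := (FP _ FX).1 a z w (or_introl Xz) (or_introl (X'X _ Xw)).
        by left; exists X.
      by right.
    + have [h|h] := (FP _ FX).1 a z w (or_introl Xz) (or_intror Gw).
        by left; exists X.
      by right.
    + have [h|h] := (FP _ FX').1 a z w (or_intror Gz) (or_introl Xw).
        by left; exists X'.
      by right.
    + by right; exact: goodG.1.
  - move=> [[X FX Xz]|Gz]; first by apply: (FP _ FX).2; left.
    exact: goodG.2.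
set H := G `|` Gam in PG; case: PG => Hlin Hp.
have H0 : H (0, 0).
  right; split=> //=; have := philin (-1) 0 0 A0 A0.
  by rewrite scaler0 addr0 mulN1r addNr.
have HZ (a : R) x r : H (x, r) -> H (a *: x, a * r).
  by move=> Hx; have := Hlin a _ _ Hx H0; rewrite /= !addr0.
have Hfun x r s : H (x, r) -> H (x, s) -> r = s.
  have h t u : H (x, t) -> H (x, u) -> t <= u.
    move=> /[swap] /(Hlin (-1)) /[apply] /Hp /=.
    by rewrite scaleN1r addNr p0 mulN1r addrC subr_le0.
  by move=> ? ?; apply/le_anti; rewrite !h.
have Htot x0 : exists r, H (x0, r).
  apply: contrapT => nx0.
  have nx r : ~ H (x0, r) by move=> Hx; apply: nx0; exists r.
  (* The value at [x0] has to lie above [r - p (y - x0)] and below [p (y + x0) - r] for all [(y, r)]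
     in [H]; by subadditivity the supremum of the former does. *)
  pose L : set R := [set t | exists y r, H (y, r) /\ t = r - p (y - x0)].
  have Lub y r : H (y, r) -> ubound L (p (y + x0) - r).
    move=> Hy _ [z [s [Hz ->]]].
    have := Hp _ (Hlin 1 _ _ Hy Hz); rewrite /= scale1r mul1r.
    have -> : y + z = (y + x0) + (z - x0) by zmod.
    by have := pD (y + x0) (z - x0); lra.
  pose c := sup L.
  have cL y r : H (y, r) -> r - p (y - x0) <= c.
    move=> Hy; apply: ub_le_sup; last by exists y, r.
    by exists (p (0 + x0) - 0); exact: Lub H0.
  have cU y r : H (y, r) -> c <= p (y + x0) - r.
    move=> Hy; apply: ge_sup; last exact: Lub.
    by exists (0 - p (0 - x0)), 0, 0.
  pose H' : set (V * R) := [set z | exists y r (a : R),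
    [/\ H (y, r), z.1 = y + a *: x0 & z.2 = r + a * c]].
  have HH' z : H z -> H' z.
    case: z => y r Hz; exists y, r, 0; split=> //=; first by rewrite scale0r addr0.
    by rewrite mul0r addr0.
  have gH' : good H'.
    split=> [a [x r] [y s]|[x r]].
      move=> [u [t [b [Hu /= -> ->]]]] [u' [t' [b' [Hu' /= -> ->]]]].
      exists (a *: u + u'), (a * t + t'), (a * b + b'); split=> /=.
      - exact: (Hlin a _ _ Hu Hu').
      - by rewrite scalerDr scalerDl scalerA addrACA.
      - by ring.
    move=> [y [s [a [Hy /= -> ->]]]].
    (* Dividing by the absolute value of [a] reduces to the coefficients 1 and -1 of [x0]. *)
    have [a0|a0|->] := ltgtP a 0; last first.
    - by rewrite scale0r mul0r !addr0; exact: Hp Hy.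
    - have := cU _ _ (HZ a^-1 _ _ Hy).
      have -> : a^-1 *: y + x0 = a^-1 *: (y + a *: x0).
        by rewrite scalerDr scalerA mulVf ?scale1r// gt_eqF.
      have ai : 0 <= a^-1 by rewrite invr_ge0 ltW.
      rewrite (pZ _ _ ai) => /(ler_wpM2l (ltW a0)).
      by rewrite mulrBr !mulrA divff ?gt_eqF// !mul1r; lra.
    - have b0 : 0 < - a by rewrite oppr_gt0.
      have := cL _ _ (HZ (- a)^-1 _ _ Hy).
      have -> : (- a)^-1 *: y - x0 = (- a)^-1 *: (y + a *: x0).
        rewrite scalerDr scalerA invrN mulNr mulVf ?scaleN1r//.
        by rewrite lt_eqF.
      have ai : 0 <= (- a)^-1 by rewrite invr_ge0 ltW.
      rewrite (pZ _ _ ai) => /(ler_wpM2l (ltW b0)).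
      by rewrite mulrBr !mulrA divff ?gt_eqF// !mul1r; lra.
  apply: (Gmax H').
    split; first by move=> z Gz; apply: HH'; left.
    move=> H'G; apply: (nx c); left; apply: H'G.
    exists 0, 0, 1; split=> //=; first by rewrite scale1r add0r.
    by rewrite mul1r add0r.
  have -> : P H' = good H'; last exact: gH'.
  rewrite /P (_ : H' `|` Gam = H')//; apply/setUidPl => z Gz.
  by apply: HH'; right.
have [psi psiP] := choice Htot; exists psi; split.
- by move=> a x y; apply: (Hfun (a *: x + y)) => //; exact: (Hlin a _ _ (psiP x) (psiP y)).
- by move=> x Ax; apply: Hfun (psiP x) _; right.
- by move=> x; exact: Hp (psiP x).
Qed.

Definition AL_space (R : realType) (X : banachLatticeType R) : Prop :=
  forall x y : X, vle lat_join 0 x -> vle lat_join 0 y ->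
    `|x + y| = `|x| + `|y|.

Section ALFunctional.
Context {R : realType} {X : banachLatticeType R}.
Hypothesis AL : AL_space X.
Let Hv : vlattice (@lat_join R X) := lat_vlattice.
Local Notation pos := (vpos (@lat_join R X)).

(** For functions in [L_1] this is the integral. *)
Definition al_int (x : X) : R := `|pos x| - `|pos (- x)|.

Lemma al_int_pos x : vle lat_join 0 x -> al_int x = `|x|.
Proof.
move=> x0; rewrite /al_int (vpos_id Hv x0).
have -> : pos (- x) = 0.
  apply: (vle_anti Hv); last exact: (vpos_ge0 Hv).
  apply: (vpos_lub Hv); last exact: (vle_refl Hv).
  by have := vleN Hv x0; rewrite oppr0.
by rewrite normr0 subr0.
Qed.

Let al_intD x y : al_int (x + y) = al_int x + al_int y.
Proof.
have px z : vle lat_join 0 (pos z) by exact: (vpos_ge0 Hv).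
(* Differences are moved across, so that both sides are sums of positive elements and the norm is
   additive on them. *)
have e : pos (x + y) + (pos (- x) + pos (- y)) =
         pos (- (x + y)) + (pos x + pos y).
  have h z : pos z = z + pos (- z) by rewrite -{2}(vpos_subN Hv z) subrK.
  by rewrite (h (x + y)) (h x) (h y); zmod.
have := congr1 Num.norm e.
rewrite !AL//; try by [|exact: (vle0D Hv)].
by rewrite /al_int; lra.
Qed.

Lemma al_int_lin (a : R) x y : al_int (a *: x + y) = a * al_int x + al_int y.
Proof.
rewrite al_intD; congr (_ + _).
have pZ b z : 0 <= b -> pos (b *: z) = b *: pos z.
  by move=> b0; rewrite /vpos -(vl_joinZ Hv)// scaler0.
wlog a0 : a x / 0 <= a.
  move=> h; case: (leP 0 a) => [|/ltW]; first exact: h.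
  rewrite -oppr_ge0 => /(h _ (- x)); rewrite scaleNr scalerN opprK => ->.
  by rewrite /al_int opprK; ring.
by rewrite /al_int -scalerN !pZ// !normrZ ger0_norm// mulrBr.
Qed.

End ALFunctional.

Lemma AL_extension (R : realType) (X Y : banachLatticeType R) (A : set Y)
    (T : Y -> X) : AL_space X -> closed_sublattice A -> lattice_hom_on A T ->
  exists q : Y -> R, [/\ seminormed_lattice (@lat_join R Y) setT q,
    forall y, q y <= opnorm_on A T * `|y|, forall a, A a -> q a = `|T a| &
    forall x y, vle lat_join 0 x -> vle lat_join 0 y -> q (x + y) = q x + q y].
Proof.
move=> AL cA hT; set M := opnorm_on A T.
have M0 : 0 <= M := opnorm_on_ge0 cA hT.
have Hv := @lat_vlattice R Y; have HX := @lat_vlattice R X.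
have sY := norm_seminormed Y; have sA := lhom_seminormed cA hT.
(* [p] vanishes on negative elements, which forces a functional dominated by it to be positive. *)
pose p (y : Y) := M * `|vpos lat_join y|.
pose phi y := al_int (T y).
have [||||||psi [psilin psiA psip]] := @hahn_banach R Y A p phi.
- exact: (csl0 cA).
- exact: (cslL cA).
- move=> x y; rewrite -mulrDr ler_wpM2l//.
  apply: le_trans (ler_normD _ _); apply: (sl_Nle_pos sY) => //.
    exact: (vpos_ge0 Hv).
  apply: (vpos_lub Hv); first by apply: (vleD Hv); exact: (vpos_ge Hv).
  by apply: (vle0D Hv); exact: (vpos_ge0 Hv).
- move=> a x a0; rewrite /p /vpos -[X in lat_join _ X](scaler0 _ a).
  by rewrite (vl_joinZ Hv)// normrZ ger0_norm// mulrCA.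
- by move=> a x y Ax Ay; rewrite /phi (lhomL hT)// al_int_lin.
- move=> x Ax; apply: le_trans (_ : `|T (vpos lat_join x)| <= _).
    by rewrite (lhom_pos cA hT)// /phi /al_int gerBl.
  by apply: (le_opnorm cA hT); exact: (sl_Dpos sA).
have psi_ge0 y : vle lat_join 0 y -> 0 <= psi y.
  move=> y0; have := psip (- y); rewrite /p.
  have -> : vpos lat_join (- y) = 0.
    apply: (vle_anti Hv); last exact: (vpos_ge0 Hv).
    apply: (vpos_lub Hv); last exact: (vle_refl Hv).
    by have := vleN Hv y0; rewrite oppr0.
  have psi0 : psi 0 = 0.
    have := psilin (-1) 0 0; rewrite scaler0 addr0; lra.
  have := psilin (-1) y 0; rewrite scaleN1r addr0 psi0 normr0 mulr0; lra.
have psi0 : psi 0 = 0.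
  have := psilin (-1) 0 0; rewrite scaler0 addr0; lra.
have psiD x y : psi (x + y) = psi x + psi y.
  by rewrite -[x in LHS]scale1r psilin mul1r.
have psiZ a x : psi (a *: x) = a * psi x.
  by rewrite -[_ *: _]addr0 psilin psi0 addr0.
have psi_le x y : vle lat_join x y -> psi x <= psi y.
  move=> xy; have := psi_ge0 _ (vsub_ge0 Hv xy).
  by have := psiD (y - x) x; rewrite subrK => ->; rewrite lerDr.
exists (fun y => psi (vabs lat_join y)); split.
- split=> //.
  + by move=> x y _ _; rewrite -psiD; apply: psi_le; exact: (vabsD Hv).
  + by move=> a x _; rewrite (vabsZ Hv) psiZ.
  + by move=> x y _ _; exact: psi_le.
- move=> y; apply: le_trans (psip _) _; rewrite /p.
  by rewrite (vpos_id Hv (vabs_ge0 Hv y)) (sl_Nabs sY).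
- move=> a Aa; rewrite psiA; last exact: (sl_Dabs sA).
  rewrite /phi (lhom_abs cA hT)// al_int_pos; last exact: (vabs_ge0 HX).
  exact: (sl_Nabs (norm_seminormed X)).
- by move=> x y x0 y0; rewrite !(vabs_id Hv)//; exact: (vle0D Hv).
Qed.

(** Positive elements of the completion are limits of images of positive elements, because taking
    positive parts is continuous. *)
Lemma AL_completion (R : realType) (V : lmodType R) (j : V -> V -> V) (D : set V)
    (N : V -> R) (S : banachLatticeType R) (i : V -> S) :
  seminormed_lattice j D N -> completion_of j D N i ->
  (forall x y, D x -> D y -> vle j 0 x -> vle j 0 y -> N (x + y) = N x + N y) ->
  AL_space S.
Proof.
move=> H cS NA z w z0 w0; have Hv := sl_vl H; have Hc := @lat_vlattice R S.
have approx (x : S) e : vle lat_join 0 x -> 0 < e ->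
    exists v, [/\ D v, vle j 0 v & `|x - i v| < e].
  move=> x0 e0; have [v Dv xv] := cpl_dense cS x e0.
  exists (vpos j v); split; [exact: (sl_Dpos H)|exact: (vpos_ge0 Hv)|].
  rewrite -(vpos_id Hc x0) /vpos (cpl_join cS)//; last exact: sl_D0 H.
  rewrite (cpl0 H cS).
  apply: le_lt_trans (sl_Njoin (norm_seminormed _) I I I I) _ => /=.
  by rewrite subrr normr0 addr0.
apply/eqP; rewrite -subr_eq0 -normr_le0; apply/ler_addgt0Pr => e ep.
have e4 : 0 < e / 4 by rewrite divr_gt0.
have [v [Dv v0 zv]] := approx z _ z0 e4.
have [u [Du u0 wu]] := approx w _ w0 e4.
have nz := le_trans (ler_dist_dist _ _) (ltW zv).
have nw := le_trans (ler_dist_dist _ _) (ltW wu).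
have nzw : `| `|z + w| - `|i v + i u| | <= e / 2.
  apply: le_trans (ler_dist_dist _ _) _.
  rewrite opprD addrACA; apply: le_trans (ler_normD _ _) _; lra.
move: nz nw nzw; rewrite -(cplD cS)// !(cpl_norm cS)//; last exact: (sl_DD H).
rewrite NA// add0r !ler_norml => /andP[a1 a2] /andP[b1 b2] /andP[c1 c2].
by apply/andP; split; lra.
Qed.

(* [t w] is the piece of [t [::]] reached along the word [w], whose most recent
   letter comes first. *)
Record split_tree (R : realType) (V : lmodType R) (j : V -> V -> V)
    (t : seq bool -> V) : Prop := SplitTree {
  st_ge0 : forall w, vle j 0 (t w) ;
  st_add : forall w, t w = t (true :: w) + t (false :: w) ;
  st_disj : forall w, vmeet j (t (true :: w)) (t (false :: w)) = 0
}.

(** * Step functions on a tree of disjoint pieces *)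

Section StepFunctions.
Context {R : realType} {V : lmodType R}.
Implicit Types (t : seq bool -> V) (g : seq bool -> R).

(* The step function with value [g u] on the piece [t u], for the words [u] of
   length [n + size w] extending [w]. *)
Fixpoint stepv t (n : nat) (w : seq bool) g : V :=
  if n is n'.+1 then stepv t n' (true :: w) g + stepv t n' (false :: w) g
  else g w *: t w.

Lemma stepv_lin t n w (a : R) g g' :
  stepv t n w (fun u => a * g u + g' u) = a *: stepv t n w g + stepv t n w g'.
Proof.
elim: n w => [|n IH] w /=; first by rewrite scalerDl scalerA.
by rewrite !IH scalerDr addrACA.
Qed.

Context {j : V -> V -> V} {t : seq bool -> V}.
Hypothesis (Hv : vlattice j) (Ht : split_tree j t).

(** Refinement by one level: both children of a piece inherit its value, the parent of the word [u]
    being [behead u]. *)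
Lemma stepv_behead n w g :
  stepv t n.+1 w (fun u => g (behead u)) = stepv t n w g.
Proof.
elim: n w => [|n IH] w; first by rewrite /= -scalerDr -(st_add Ht).
by rewrite -[LHS]/(stepv t n.+1 (true :: w) _ + stepv t n.+1 (false :: w) _) !IH.
Qed.

Lemma stepv_drop k n w g :
  stepv t (k + n) w (fun u => g (drop k u)) = stepv t n w g.
Proof.
elim: k g => [|k IH] g.
  by rewrite add0n; congr stepv; apply/funext => u; rewrite drop0.
have -> : (fun u => g (drop k.+1 u)) = (fun u => g (drop k (behead u))).
  by apply/funext => -[|b u].
by rewrite addSn (stepv_behead _ _ (fun u => g (drop k u))).
Qed.

(** Step functions below [w] stay in the ideal generated by [t w]; those below the two children of a
    piece are therefore disjoint. *)
Lemma stepv_bound n w g : exists2 c : R, 0 <= c &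
  vle j (vabs j (stepv t n w g)) (c *: t w).
Proof.
elim: n w => [|n IH] w /=.
  exists `|g w| => //; rewrite (vabsZ Hv) (vabs_id Hv); first exact: (vle_refl Hv).
  exact: st_ge0 Ht w.
have [c c0 hc] := IH (true :: w); have [d d0 hd] := IH (false :: w).
exists (c + d); first exact: addr_ge0.
apply: (vle_trans Hv) (vabsD Hv _ _) _.
rewrite (st_add Ht) scalerDr; apply: (vleD Hv).
  apply: (vle_trans Hv) hc _; rewrite scalerDl; apply: (vle_paddr Hv).
    by apply: (vle0Z Hv) => //; exact: st_ge0 Ht _.
  exact: (vle_refl Hv).
apply: (vle_trans Hv) hd _; rewrite scalerDl addrC; apply: (vle_paddr Hv).
  by apply: (vle0Z Hv) => //; exact: st_ge0 Ht _.
exact: (vle_refl Hv).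
Qed.

Lemma stepv_join n w g g' :
  stepv t n w (fun u => Num.max (g u) (g' u)) = j (stepv t n w g) (stepv t n w g').
Proof.
elim: n w => [|n IH] w /=.
  wlog gg : g g' / g w <= g' w.
    move=> h; case: (leP (g w) (g' w)) => gg.
      by have := h _ _ gg; rewrite (max_idPr gg).
    by have := h _ _ (ltW gg); rewrite (max_idPr (ltW gg)) (vl_joinC Hv).
  rewrite (max_idPr gg); apply/esym; rewrite -/(vle j _ _).
  apply: (vsubr_ge0 Hv); rewrite -scalerBl; apply: (vle0Z Hv); last exact: st_ge0 Ht w.
  by rewrite subr_ge0.
rewrite !IH.
have [c c0 hc] := stepv_bound n (true :: w) g.
have [c' c'0 hc'] := stepv_bound n (true :: w) g'.
have [d d0 hd] := stepv_bound n (false :: w) g.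
have [d' d'0 hd'] := stepv_bound n (false :: w) g'.
(* A common bound for the four coefficients. *)
pose K : R := c + c' + d + d'.
have K0 : 0 <= K by rewrite !addr_ge0.
have leK x (b : R) v : b <= K -> vle j x (b *: t v) -> vle j x (K *: t v).
  move=> bK h; apply: (vle_trans Hv) h _; apply: (vsubr_ge0 Hv).
  rewrite -scalerBl; apply: (vle0Z Hv); last exact: st_ge0 Ht v.
  by rewrite subr_ge0.
apply/esym/(@vjoinD_disjoint _ _ _ Hv (K *: t (true :: w)) (K *: t (false :: w))).
- by apply: (vle0Z Hv) => //; exact: st_ge0 Ht _.
- by apply: (vle0Z Hv) => //; exact: st_ge0 Ht _.
- by rewrite (vmeetZ Hv)// (st_disj Ht) scaler0.
- by apply: leK hc; rewrite /K; lra.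
- by apply: leK hc'; rewrite /K; lra.
- by apply: leK hd; rewrite /K; lra.
- by apply: leK hd'; rewrite /K; lra.
Qed.

Lemma stepv_abs n w g :
  vabs j (stepv t n w g) = stepv t n w (fun u => `|g u|).
Proof.
have -> : (fun u => `|g u|) = (fun u => Num.max (g u) ((-1) * g u + 0)).
  apply/funext => u; rewrite addr0 mulN1r; case: (leP 0 (g u)) => g0.
    by rewrite ger0_norm// max_l//; lra.
  by rewrite ltr0_norm// max_r//; lra.
rewrite stepv_join /vabs; congr j; have := stepv_lin t n w (-1) g (fun=> 0).
have -> : stepv t n w (fun=> 0) = 0.
  by elim: n w => [|n IH] w /=; rewrite ?scale0r// !IH addr0.
by move=> ->; rewrite addr0 scaleN1r.
Qed.

Lemma stepv_ge0 n w g : (forall u, 0 <= g u) -> vle j 0 (stepv t n w g).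
Proof.
move=> g0; elim: n w => [|n IH] w /=; last exact: (vle0D Hv).
by apply: (vle0Z Hv) => //; exact: st_ge0 Ht w.
Qed.

End StepFunctions.

(** The norm of a step function in an AL-space, computed from the norms [m] of the pieces alone. *)
Fixpoint stepn (R : realType) (m : seq bool -> R) (n : nat) (w : seq bool)
    (g : seq bool -> R) : R :=
  if n is n'.+1 then stepn m n' (true :: w) g + stepn m n' (false :: w) g
  else `|g w| * m w.

Lemma norm_stepv (R : realType) (Z : banachLatticeType R) (t : seq bool -> Z)
    n w g : AL_space Z -> split_tree lat_join t ->
  `|stepv t n w g| = stepn (fun u => `|t u|) n w g.
Proof.
move=> AL Ht; have Hv := @lat_vlattice R Z.
rewrite -(sl_Nabs (norm_seminormed Z))// (stepv_abs Hv Ht).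
elim: n w => [|n IH] w /=; first by rewrite normrZ normr_id.
by rewrite AL ?IH//; apply: (stepv_ge0 Hv Ht) => u; exact: normr_ge0.
Qed.

(** Step functions with the same values correspond. An element may have several such expressions;
    equal masses of the pieces make the relation norm-preserving, hence single-valued. *)
Lemma split_tree_embedding (R : realType) (Z S : banachLatticeType R)
    (t : seq bool -> Z) (t' : seq bool -> S) : AL_space Z -> AL_space S ->
  split_tree lat_join t -> split_tree lat_join t' ->
  (forall w, `|t' w| = `|t w|) ->
  (forall z (e : R), 0 < e -> exists n g, `|z - stepv t n [::] g| < e) ->
  exists h : Z -> S, embedding h.
Proof.
move=> AZ AS Ht Ht' tt' td.
have HZ := @lat_vlattice R Z; have HS := @lat_vlattice R S.
pose G (z : Z) (s : S) := exists n g,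
  z = stepv t n [::] g /\ s = stepv t' n [::] g.
have common z s z' s' : G z s -> G z' s' -> exists n g g',
    [/\ z = stepv t n [::] g, s = stepv t' n [::] g,
        z' = stepv t n [::] g' & s' = stepv t' n [::] g'].
  move=> [n [g [-> ->]]] [n' [g' [-> ->]]].
  (* Both step functions are refined to a common level. *)
  exists (n' + n)%N, (fun u => g (drop n' u)), (fun u => g' (drop n u)).
  by split; rewrite ?(stepv_drop Ht) ?(stepv_drop Ht')//
    [(n' + n)%N]addnC ?(stepv_drop Ht) ?(stepv_drop Ht').
have [||||h eh _] := @graph_embedding R Z S G; last by exists h.
- move=> a z s z' s' zs zs'.
  have [n [g [g' [-> -> -> ->]]]] := common _ _ _ _ zs zs'.
  by exists n, (fun u => a * g u + g' u); rewrite !stepv_lin.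
- move=> z s z' s' zs zs'.
  have [n [g [g' [-> -> -> ->]]]] := common _ _ _ _ zs zs'.
  exists n, (fun u => Num.max (g u) (g' u)).
  by rewrite (stepv_join HZ Ht) (stepv_join HS Ht').
- move=> _ _ [n [g [-> ->]]]; rewrite !norm_stepv//.
  by congr stepn; apply/funext => w.
- move=> z e e0; have [n [g zg]] := td z e e0.
  by exists (stepv t n [::] g), (stepv t' n [::] g); split=> //; exists n, g.
Qed.

(** For functions, these are the products of [e] with indicator functions. *)
Definition component (R : realType) (V : lmodType R) (j : V -> V -> V)
    (e x : V) : Prop :=
  [/\ vle j 0 x, vle j 0 (e - x) & vmeet j x (e - x) = 0].

Section ComponentTree.
Context {R : realType} {V : lmodType R} {j : V -> V -> V}.
Hypothesis Hv : vlattice j.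
Variables (e : V) (c : nat -> V).

Hypotheses (e0 : vle j 0 e) (cP : forall k, component j e (c k)).

(** The [k]-th letter, counted from the end of the word, tells whether the piece lies in [c k] or in
    its complement. Pieces may vanish. *)
Fixpoint ctree (w : seq bool) : V :=
  if w is b :: w' then
    vmeet j (ctree w') (if b then c (size w') else e - c (size w'))
  else e.

Lemma ctree_ge0 w : vle j 0 (ctree w).
Proof.
elim: w => [|b w IH] //=; have [c0 ec0 _] := cP (size w).
by apply: (vmeet_ge0 Hv) => //; case: b.
Qed.

Lemma ctree_le w : vle j (ctree w) e.
Proof.
elim: w => [|b w IH] /=; first exact: (vle_refl Hv).
exact: (vle_trans Hv (vleIl Hv _ _)).
Qed.

Lemma ctree_split : split_tree j ctree.
Proof.
split; first exact: ctree_ge0.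
  move=> w /=; have [c0 ec0 cec] := cP (size w).
  rewrite (vmeet_split Hv)//; first exact: ctree_ge0.
  by rewrite addrC subrK; exact: ctree_le.
move=> w /=; have [c0 ec0 cec] := cP (size w); have t0 := ctree_ge0 w.
apply: (vmeet0_le Hv) cec; [exact: (vmeet_ge0 Hv)|exact: (vmeet_ge0 Hv)| | ];
  exact: (vleIr Hv).
Qed.

(** [c k] is the sum of the pieces of level [k.+1] whose newest letter is [true]. The induction
    concerns the part below a word [w], where the sum is the meet of [ctree w] and [c k], cut by
    [c (size w)] and its complement. *)
Lemma stepv_component k :
  stepv ctree k.+1 [::] (fun u => (head false u)%:R) = c k.
Proof.
suff h n w : (size w + n)%N = k ->
    stepv ctree n.+1 w (fun u => (head false u)%:R) = vmeet j (ctree w) (c k).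
  have [c0 ec0 _] := cP k.
  rewrite h// (vmeetC Hv) vmeet_l//.
  exact: (vsubr_ge0 Hv).
elim: n w => [|n IH] w wn.
  by rewrite /= scale1r scale0r addr0 -wn addn0.
rewrite -[LHS]/(stepv ctree n.+1 (true :: w) _ + stepv ctree n.+1 (false :: w) _).
rewrite !IH /=; try by rewrite addSnnS.
have [c0 ec0 cec] := cP (size w); have [ck0 eck0 _] := cP k.
have t0 := ctree_ge0 w.
have swap x y z : vmeet j (vmeet j x y) z = vmeet j (vmeet j x z) y.
  by rewrite -!(vmeetA Hv) (vmeetC Hv y).
rewrite !(swap (ctree w) _ (c k)); apply: (vmeet_split Hv) => //.
  exact: (vmeet_ge0 Hv).
apply: (vle_trans Hv (vleIl Hv _ _)); rewrite addrC subrK; exact: ctree_le.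
Qed.

End ComponentTree.

(** * Order limits and components in AL-spaces *)

Section OrderLimits.
Context {R : realType} {Z : banachLatticeType R}.
Implicit Types (x y l e : Z).
Let Hv : vlattice (@lat_join R Z) := lat_vlattice.
Let sZ := norm_seminormed Z.
Local Notation vle := (vle (@lat_join R Z)).
Local Notation meet := (vmeet (@lat_join R Z)).
Local Notation pos := (vpos (@lat_join R Z)).

Lemma vle_closedl x l : (forall d : R, 0 < d -> exists2 y, vle x y & `|y - l| < d) ->
  vle x l.
Proof.
move=> h; apply/eqP; rewrite -subr_eq0 -normr_le0; apply/ler_addgt0Pr => d d0.
have [y xy yl] := h _ (divr_gt0 d0 (ltr0n _ 2)); rewrite add0r.
have := ler_distD y (lat_join x l) l.
have := sl_Njoin sZ (I : setT x) (I : setT l) (I : setT x) (I : setT y).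
by rewrite /= xy subrr normr0 (distrC l y); lra.
Qed.

Lemma vle_closedr x l : (forall d : R, 0 < d -> exists2 y, vle y x & `|y - l| < d) ->
  vle l x.
Proof.
move=> h; rewrite -[l]opprK -[x]opprK; apply: (vleN Hv).
apply: vle_closedl => d /h[y yx yl]; exists (- y); first exact: (vleN Hv).
by rewrite -opprD normrN.
Qed.

Lemma norm_meet x y x' y' : `|meet x y - meet x' y'| <= `|x - x'| + `|y - y'|.
Proof.
rewrite !(vmeetE Hv) -opprD normrN.
apply: le_trans (sl_Njoin sZ (I : setT (- x)) (I : setT (- y))
  (I : setT (- x')) (I : setT (- y'))) _ => /=.
by rewrite -!opprD !normrN.
Qed.

Lemma cvg0_ex (u : nat -> R) (m : nat) (d : R) : u n @[n --> \oo] --> 0 -> 0 < d ->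
  exists2 n, (m <= n)%N & `|u n| < d.
Proof.
move=> /cvgr0Pnorm_lt h /h ud.
by have [n [? ?]] := filter_ex (filterI ud (nbhs_infty_ge m)); exists n.
Qed.

Hypothesis AL : AL_space Z.

(** Additivity turns the norm of [u m - u n] into the difference of the norms, and these form a
    bounded increasing sequence. *)
Lemma AL_incr_cvg (u : nat -> Z) e : (forall n, vle 0 (u n)) ->
  (forall n, vle (u n) (u n.+1)) -> (forall n, vle (u n) e) ->
  exists l, `|u n - l| @[n --> \oo] --> 0.
Proof.
move=> u0 uS ue.
have umono n m : (n <= m)%N -> vle (u n) (u m).
  move=> /subnKC <-; elim: (m - n)%N => [|k IH].
    by rewrite addn0; exact: (vle_refl Hv).
  by rewrite addnS; exact: (vle_trans Hv IH).
have diff n m : (n <= m)%N -> `|u m - u n| = `|u m| - `|u n|.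
  move=> /umono nm; have := AL (u0 n) (vsub_ge0 Hv nm).
  by rewrite addrC subrK; lra.
have : cvgn (fun n => `|u n|).
  apply: nondecreasing_is_cvgn.
    by move=> n m /umono nm; exact: (sl_Nle_pos sZ).
  by exists `|e| => _ [n _ <-]; apply: (sl_Nle_pos sZ).
move=> /cvg_ex[a ua].
have : cvg (u @ \oo).
  apply: cauchy_cvg; apply/cauchyP => d d0.
  have d2 : 0 < d / 2 by rewrite divr_gt0.
  have /cvgrPdist_lt/(_ _ d2)[m _ hm] := ua.
  exists (u m); exists m => // k /= mk; rewrite -ball_normE /= distrC diff//.
  apply: le_lt_trans (ler_norm _) _.
  have := hm _ (leqnn m : [set n | (m <= n)%N] m); have := hm _ (mk : [set n | (m <= n)%N] k).
  have := ler_distD a `|u k| `|u m|; rewrite (distrC _ a) /=; lra.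
move=> /cvg_ex[l ul']; exists l; apply/cvgr0Pnorm_lt => d d0.
move/cvgrPdist_lt : ul' => /(_ _ d0).
by apply: filterS => n; rewrite distrC normr_id.
Qed.

Section Component.
Variable e : Z.
Hypothesis e0 : vle 0 e.

(* [c] is the component of [e] in the band generated by the positive part of [z];
   for functions and [e = 1] it is the indicator of [z > 0]. *)
Definition component_of (z c : Z) : Prop :=
  `|meet e (n%:R *: pos z) - c| @[n --> \oo] --> 0.

Let u (z : Z) (n : nat) := meet e (n%:R *: pos z).

Let u_ge0 z n : vle 0 (u z n).
Proof.
apply: (vmeet_ge0 Hv) => //; apply: (vle0Z Hv) => //; exact: (vpos_ge0 Hv).
Qed.

Let u_mono z n m : (n <= m)%N -> vle (u z n) (u z m).
Proof.
move=> nm; apply: (vleI2 Hv); first exact: (vle_refl Hv).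
apply: (vsubr_ge0 Hv); rewrite -scalerBl; apply: (vle0Z Hv).
  by rewrite subr_ge0 ler_nat.
exact: (vpos_ge0 Hv).
Qed.

Let u_le z n : vle (u z n) e. Proof. exact: (vleIl Hv). Qed.

Lemma component_of_exists z : exists c, component_of z c.
Proof. by apply: (AL_incr_cvg (u_ge0 z) _ (u_le z)) => n; exact: u_mono. Qed.

Let u_lec z c n : component_of z c -> vle (u z n) c.
Proof.
move=> zc; apply: vle_closedl => d d0.
have [m nm] := cvg0_ex n zc d0; rewrite normr_id => mc.
by exists (u z m) => //; exact: u_mono.
Qed.

Let lec z c x : component_of z c -> (forall n, vle (u z n) x) -> vle c x.
Proof.
move=> zc ux; apply: vle_closedr => d d0.
have [m _] := cvg0_ex 0 zc d0; rewrite normr_id => mc.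
by exists (u z m).
Qed.

(** Adding [c] turns the disjointness of [c] and [e - c] into [meet (2 *: c) e = c]. This holds in
    the limit because doubling the [n]-th approximation and cutting it at [e] gives the one of index
    [2 * n]. *)
Lemma component_ofP z c : component_of z c -> component lat_join e c.
Proof.
move=> zc; have c0 : vle 0 c by exact: (vle_trans Hv (u_ge0 z 0) (u_lec 0 zc)).
have ce : vle c e by exact: lec zc (u_le z).
split=> //; first exact: (vsub_ge0 Hv).
suff : meet (2 *: c) e = c.
  move=> h; have := vmeetD Hv c (e - c) c.
  rewrite subrK -mulr2n -scaler_nat h => /(congr1 (fun x => x - c)).
  by rewrite addrK subrr => <-.
apply: (vle_anti Hv); last first.
  apply: (vlexI Hv) => //; rewrite scaler_nat mulr2n.
  exact: (vle_paddr Hv c0 (vle_refl Hv c)).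
apply: vle_closedr => d d0; have d2 : 0 < d / 2 by rewrite divr_gt0.
have [n _] := cvg0_ex 0 zc d2; rewrite normr_id => nc.
exists (meet (2 *: u z n) e).
  suff -> : meet (2 *: u z n) e = u z (2 * n)%N by exact: u_lec.
  rewrite /u -(vmeetZ Hv)// scalerA -natrM (vmeetC Hv (2 *: e)) -(vmeetA Hv).
  rewrite (vmeetC Hv (2 *: e)) (vmeetC Hv _ (meet _ _)); congr (vmeet _ _ _).
  apply: vmeet_l; rewrite scaler_nat mulr2n.
  exact: (vle_paddr Hv e0 (vle_refl Hv e)).
apply: le_lt_trans (norm_meet _ _ _ _) _.
rewrite subrr normr0 addr0 -scalerBr normrZ ger0_norm//.
by rewrite -ltr_pdivlMl// mulrC.
Qed.

(** For functions and [e = 1], the minimum of [pos z] and [d] is at most [d] on [z > 0] and zero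
    elsewhere. Any [n >= d^-1] suffices in the approximation of [c]. *)
Lemma component_of_ge z c (d : R) : 0 < d -> component_of z c ->
  vle (meet (pos z) (d *: e)) (d *: c).
Proof.
move=> d0 zc; have [n dn] : exists n : nat, d^-1 <= n%:R.
  by exists (Num.truncn d^-1).+1; apply/ltW; exact: truncnS_gt.
apply: (vle_trans Hv (_ : vle _ (d *: u z n))); last first.
  by apply: (vleZ Hv); [exact: ltW|exact: u_lec].
rewrite /u -(vmeetZ Hv) ?ltW// (vmeetC Hv); apply: (vleI2 Hv).
  exact: (vle_refl Hv).
rewrite scalerA; apply: (vsubr_ge0 Hv); rewrite -{2}[pos z]scale1r -scalerBl.
apply: (vle0Z Hv); last exact: (vpos_ge0 Hv).
by rewrite subr_ge0 -ler_pdivrMl// mulr1.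
Qed.

(** For functions and [e = 1], both [pos z] and [d] are at least [d] on the set [z > d]. *)
Lemma component_of_le z c (d : R) : 0 < d -> component_of (z - d *: e) c ->
  vle (d *: c) (meet (pos z) (d *: e)).
Proof.
move=> d0 zc; have dd : 0 <= d by exact: ltW.
have de0 : vle 0 (d *: e) by exact: (vle0Z Hv).
rewrite -[meet _ _](scalerKV (lt0r_neq0 d0)); apply: (vleZ Hv) => //.
apply: lec zc _ => n; rewrite -[u _ n](scalerK (lt0r_neq0 d0)).
apply: (vleZ Hv); first by rewrite invr_ge0.
rewrite /u -(vmeetZ Hv)//; set w := pos (z - d *: e).
apply: (vlexI Hv); last exact: (vleIl Hv).
rewrite scalerA; set k := d * n%:R.
have k0 : 0 <= k by rewrite mulr_ge0.
set p := pos z; set m := meet (d *: e) (k *: w).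
have w0 : vle 0 w by exact: (vpos_ge0 Hv).
have kw0 : vle 0 (k *: w) by exact: (vle0Z Hv).
have p0 : vle 0 p by exact: (vpos_ge0 Hv).
(* [w] lives where [z] exceeds [d *: e], and there [d *: e - p] has no positive part. *)
have h0 : meet (pos (d *: e - p)) (k *: w) = 0.
  apply: (vmeet0Z Hv) => //; first exact: (vpos_ge0 Hv).
  apply: (vmeet0_le Hv) (vpos_disjoint Hv (d *: e - z)) => //.
  - exact: (vpos_ge0 Hv).
  - apply: (vpos_le Hv); apply: (vsubr_ge0 Hv).
    have -> : d *: e - z - (d *: e - p) = p - z by zmod.
    by apply: (vsub_ge0 Hv); exact: (vpos_ge Hv).
  - by rewrite opprB; exact: (vle_refl Hv).
(* [pos (m - p)] lies below both members of the disjoint pair in [h0]. *)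
suff mp : vle (pos (m - p)) 0.
  by rewrite -[p]add0r; apply: (vle_addr Hv); exact: (vle_trans Hv (vpos_ge Hv _)).
rewrite -h0; apply: (vlexI Hv).
  by apply: (vpos_le Hv); apply: (vleD2r Hv); exact: (vleIl Hv).
apply: (vpos_lub Hv) => //; apply: (vle_trans Hv (_ : vle _ m)); last exact: (vleIr Hv).
by rewrite -{2}[m]subr0; apply: (vleD Hv (vle_refl Hv m)); exact: (vleN Hv).
Qed.

(** Freudenthal's approximation by layers: the slice [s k] of [y] between the heights [k * d] and
    [k.+1 * d] lies between [d *: c k.+1] and [d *: c k], so that the error telescopes to at most
    [d *: c 0]. *)
Lemma dyadic_approx (P : Z -> Z) (y : Z) (d : R) (K : nat) :
  (forall z, component_of z (P z)) -> 0 < d -> vle 0 y ->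
  vle y ((K%:R * d) *: e) ->
  `|y - \sum_(k < K) d *: P (y - (k.+1%:R * d) *: e)| <= d * `|e|.
Proof.
move=> PP d0 y0 yK; have dd := ltW d0.
pose c k := P (y - (k%:R * d) *: e).
pose s k := meet (pos (y - (k%:R * d) *: e)) (d *: e).
have sE k : meet y ((k%:R * d) *: e) + s k = meet y ((k.+1%:R * d) *: e).
  set t := (k%:R * d) *: e.
  have -> : (k.+1%:R * d) *: e = t + d *: e by rewrite -natr1 mulrDl mul1r scalerDl.
  rewrite /s -/t; have -> : pos (y - t) = y - meet y t.
    by rewrite /vpos -(subrr t) (vl_joinD Hv) /vmeet; zmod.
  rewrite addrC -(vmeetD Hv) subrK addrC -(vmeetD Hv) (vmeetA Hv).
  have yy : vle y (y + d *: e).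
    by apply: (vle_paddr Hv) (vle_refl Hv y); exact: (vle0Z Hv).
  by rewrite (vmeet_l yy).
have ysum : y = \sum_(k < K) s k.
  have -> : y = meet y ((K%:R * d) *: e) by rewrite vmeet_l.
  elim: (K) => [|k IH].
    rewrite big_ord0 mul0r scale0r (vmeetC Hv) vmeet_l//.
  by rewrite big_ord_recr /= -IH sE.
have cs k : vle (d *: c k.+1) (s k).
  apply: component_of_le => //.
  have -> : y - (k%:R * d) *: e - d *: e = y - (k.+1%:R * d) *: e.
    by rewrite -natr1 mulrDl mul1r scalerDl; zmod.
  exact: PP.
have sc k : vle (s k) (d *: c k) by apply: component_of_ge.
have sumle (f g : nat -> Z) n : (forall k, vle (f k) (g k)) ->
    vle (\sum_(k < n) f k) (\sum_(k < n) g k).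
  move=> fg; elim: n => [|n IH]; first by rewrite !big_ord0; exact: (vle_refl Hv).
  by rewrite !big_ord_recr /=; exact: (vleD Hv).
have tele n : \sum_(k < n) (d *: c k - d *: c k.+1) = d *: c 0%N - d *: c n.
  elim: n => [|n IH]; first by rewrite big_ord0 subrr.
  by rewrite big_ord_recr /= IH; zmod.
set S := \sum_(k < K) _; have S_le : vle S y.
  by rewrite ysum; exact: (sumle (fun k => d *: c k.+1) s).
have -> : d * `|e| = `|d *: e| by rewrite normrZ gtr0_norm.
apply: (sl_Nle_pos sZ) => //; first exact: (vsub_ge0 Hv).
apply: (vle_trans Hv (_ : vle _ (d *: c 0%N - d *: c K))).
  rewrite -tele sumrB; apply: (vleD2r Hv); rewrite {1}ysum.
  exact: (sumle s (fun k => d *: c k)).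
have [c0 ec _] := component_ofP (PP (y - (0%:R * d) *: e)).
have [ck0 _ _] := component_ofP (PP (y - (K%:R * d) *: e)).
apply: (vle_trans Hv (_ : vle _ (d *: c 0%N))).
  rewrite -{2}[d *: c 0%N]subr0; apply: (vleD Hv (vle_refl Hv _)).
  by apply: (vleN Hv); exact: (vle0Z Hv).
by apply: (vleZ Hv) => //; exact: (vsubr_ge0 Hv).
Qed.

End Component.

(** [e] sums the absolute values of a dense sequence [f], with weights that make the series
    converge; each [f k] is thus dominated by a multiple of [e]. The components are those of
    [pos (f k)] above dyadic heights, and the layers between these heights approximate
    [pos (f k)]. *)
Lemma separable_components : separable Z -> exists (e : Z) (c : nat -> Z),
  [/\ vle 0 e, forall k, component lat_join e (c k) &
      forall W : set Z, W 0 ->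
        (forall (a : R) x y, W x -> W y -> W (a *: x + y)) ->
        (forall k, W (c k)) ->
        forall z (d : R), 0 < d -> exists2 w, W w & `|z - w| < d].
Proof.
move=> /separableP[D cD dD].
have [f fD] : exists f : nat -> Z, set_surj [set: nat] D f by exact/pcard_surjP.
pose a k : Z := (2^-1 ^+ k / (1 + `|f k|)) *: vabs lat_join (f k).
have a0 k : vle 0 (a k).
  apply: (vle0Z Hv); last exact: (vabs_ge0 Hv).
  by rewrite divr_ge0 ?exprn_ge0// addr_ge0.
pose E n : Z := \sum_(k < n) a k.
have ES n : E n.+1 = E n + a n by rewrite /E big_ord_recr.
have [n|e Ee] := @fast_cvg R Z E.
  rewrite ES addrC addKr normrZ (sl_Nabs sZ)//.
  have n1 : 0 < 1 + `|f n| by rewrite ltr_wpDr.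
  have p0 : 0 <= 2^-1 ^+ n :> R by rewrite exprn_ge0.
  rewrite ger0_norm; last by rewrite divr_ge0// ltW.
  rewrite -mulrA ler_piMr// mulrC ler_pdivrMr// mul1r; lra.
have Emono n m : (n <= m)%N -> vle (E n) (E m).
  move=> /subnKC <-; elim: (m - n)%N => [|k IH].
    by rewrite addn0; exact: (vle_refl Hv).
  rewrite addnS ES; exact: (vle_paddr Hv).
have Ele n : vle (E n) e.
  apply: vle_closedl => d d0; have [m nm] := cvg0_ex n Ee d0.
  by rewrite normr_id => mE; exists (E m) => //; exact: Emono.
have e0 : vle 0 e by have := Ele 0%N; rewrite /E big_ord0.
have fe k : exists K : nat, vle (vabs lat_join (f k)) (K%:R *: e).
  pose r : R := (1 + `|f k|) / 2^-1 ^+ k.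
  have r0 : 0 < r by rewrite divr_gt0 ?exprn_gt0// ltr_wpDr.
  exists (Num.truncn r).+1.
  apply: (vle_trans Hv (_ : vle _ (r *: e))); last first.
    apply: (vsubr_ge0 Hv); rewrite -scalerBl; apply: (vle0Z Hv) => //.
    by rewrite subr_ge0 ltW// truncnS_gt.
  have -> : vabs lat_join (f k) = r *: a k.
    rewrite /a scalerA /r mulrACA [_^-1 * _]mulrC mulrACA.
    have n1 : 0 < 1 + `|f k| by rewrite ltr_wpDr.
    have q1 : 0 < 2^-1 ^+ k :> R by rewrite exprn_gt0.
    by rewrite divff ?gt_eqF// divff ?gt_eqF// mul1r scale1r.
  apply: (vleZ Hv); first exact: ltW.
  apply: (vle_trans Hv _ (Ele k.+1)); rewrite ES addrC.
  apply: (vle_paddr Hv); last exact: (vle_refl Hv).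
  by have := Emono 0%N k isT; rewrite {1}/E big_ord0.
have [P PP] := choice (component_of_exists e0).
pose g (i : nat * nat * nat) :=
  P (pos (f i.1.1) - (i.1.2%:R * 2^-1 ^+ i.2) *: e).
(* [0] is a component of [e], so it can stand for the codes that decode to nothing. *)
pose c k := if unpickle k is Some i then g i else 0.
exists e, c; split=> // [k|W W0 Wl Wc z d d0].
  rewrite /c; case: (unpickle k) => [i|]; first exact: component_ofP (PP _).
  split; [exact: (vle_refl Hv)|by rewrite subr0|].
  by rewrite vmeet_l// subr0.
have Wg i : W (g i) by have := Wc (pickle i); rewrite /c pickleK.
have WD x y : W x -> W y -> W (x + y).
  by move=> Wx Wy; rewrite -[x]scale1r; exact: Wl.
have WZ (b : R) x : W x -> W (b *: x).
  by move=> Wx; rewrite -[_ *: _]addr0; exact: Wl.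
have approx x (h : R) : vle 0 x -> 0 < h -> exists2 w, W w & `|x - w| < h.
  move=> x0 h0; have h2 : 0 < h / 2 by rewrite divr_gt0.
  have [_ /fD[k _ <-] xk] := dD x _ h2.
  have [K yK] := fe k; pose y := pos (f k).
  have y0 : vle 0 y by exact: (vpos_ge0 Hv).
  have yK' : vle y (K%:R *: e) by exact: (vle_trans Hv (vpos_le_abs Hv _)).
  (* Taking positive parts brings [f k] into the cone without increasing its distance to [x]. *)
  have xy : `|x - y| < h / 2.
    rewrite -(vpos_id Hv x0); apply: le_lt_trans xk.
    apply: le_trans (sl_Njoin sZ I I I I) _.
    by rewrite /= subrr normr0 addr0.
  have h3 : 0 < h / 2 / (1 + `|e|) by rewrite !divr_gt0// ltr_wpDr.
  have [n /= nh] := filter_ex (near_expr_lt h3).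
  pose q : R := 2^-1 ^+ n.
  have q0 : 0 < q by rewrite exprn_gt0.
  (* [K * 2 ^ n] layers of height [2^-1 ^+ n] reach exactly [K%:R *: e]. *)
  have yK2 : vle y (((K * 2 ^ n)%N%:R * q) *: e).
    by rewrite natrM -mulrA natrX -exprMn divff ?expr1n ?mulr1.
  have := dyadic_approx e0 PP q0 y0 yK2.
  set w := \sum_(k < _) _ => yw; exists w.
    apply: (big_ind W) => // i _; apply: WZ.
    exact: (Wg (k, i.+1, n)).
  apply: le_lt_trans (ler_distD y _ _) _; rewrite [ltRHS]splitr.
  apply: ltr_leD => //; apply: le_trans yw _.
  apply: le_trans (_ : q * (1 + `|e|) <= _).
    by rewrite ler_pM2l// lerDr.
  by rewrite -ler_pdivlMr ?ltr_wpDr// ltW.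
have d2 : 0 < d / 2 by rewrite divr_gt0.
have [w1 Ww1 h1] := approx (pos z) _ (vpos_ge0 Hv z) d2.
have [w2 Ww2 h2] := approx (pos (- z)) _ (vpos_ge0 Hv _) d2.
exists (-1 *: w2 + w1); first exact: Wl.
rewrite -{1}(vpos_subN Hv z) scaleN1r.
have -> : pos z - pos (- z) - (- w2 + w1) = (pos z - w1) - (pos (- z) - w2).
  by zmod.
by apply: le_lt_trans (ler_normB _ _) _; rewrite [ltRHS]splitr ltrD.
Qed.

End OrderLimits.

(** Left endpoint of the interval given to [w]: the child [true] keeps that of its parent, the child
    [false] starts where its sibling ends. *)
Fixpoint offset (R : realType) (m : seq bool -> R) (w : seq bool) : R :=
  if w is b :: w' then offset m w' + (if b then 0 else m (true :: w')) else 0.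

(* The pieces of the tree of components are laid out side by side as
   intervals whose lengths are their norms. *)
Lemma AL_interval_embedding (R : realType) (Z S : banachLatticeType R)
    (chi : R -> R -> S) : AL_space Z -> AL_space S -> separable Z ->
  (forall a b, a <= b -> vle lat_join 0 (chi a b)) ->
  (forall a b c, a <= b -> b <= c -> chi a c = chi a b + chi b c) ->
  (forall a b c, a <= b -> b <= c -> vmeet lat_join (chi a b) (chi b c) = 0) ->
  (forall a b, a <= b -> `|chi a b| = b - a) ->
  exists h : Z -> S, embedding h.
Proof.
move=> AZ AS sZ chi0 chiD chiI chiN.
have Hv := @lat_vlattice R Z.
have [e [c [e0 cP cd]]] := separable_components AZ sZ.
pose t := ctree (j := lat_join) e c.
have Ht : split_tree lat_join t := ctree_split Hv e0 cP.
pose m (w : seq bool) : R := `|t w|.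
have m0 w : 0 <= m w by exact: normr_ge0.
have mS w : m w = m (true :: w) + m (false :: w).
  by rewrite /m {1}(st_add Ht) AZ//; exact: st_ge0 Ht _.
pose t' w := chi (offset m w) (offset m w + m w).
have le1 w : offset m w <= offset m w + m (true :: w) by rewrite lerDl.
have le2 w : offset m w + m (true :: w) <= offset m w + m w.
  by rewrite lerD2l (mS w) lerDl.
have tT w : t' (true :: w) = chi (offset m w) (offset m w + m (true :: w)).
  by rewrite /t' /= addr0.
have tF w : t' (false :: w) = chi (offset m w + m (true :: w)) (offset m w + m w).
  by rewrite /t' /= -addrA -mS.
apply: (split_tree_embedding (t := t) (t' := t')) => //.
- split=> w; first by apply: chi0; rewrite lerDl.
    by rewrite tT tF; apply: chiD.
  by rewrite tT tF; apply: chiI.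
- by move=> w; rewrite chiN ?lerDl// addrC addKr.
- pose W : set Z := [set z | exists n g, z = stepv t n [::] g].
  have W0 : W 0 by exists 0%N, (fun=> 0); rewrite /= scale0r.
  have Wl (a : R) x y : W x -> W y -> W (a *: x + y).
    move=> [n [g ->]] [n' [g' ->]].
    exists (n' + n)%N, (fun u => a * g (drop n' u) + g' (drop n u)).
    rewrite stepv_lin (stepv_drop Ht); congr (_ + _).
    by rewrite addnC (stepv_drop Ht).
  have Wc k : W (c k).
    exists k.+1, (fun u => (head false u)%:R).
    by rewrite (stepv_component Hv e0 cP).
  move=> z d d0; have [_ [n [g ->]] zg] := cd W W0 Wl Wc z d d0.
  by exists n, g.
Qed.

(** * The Banach lattice L1 *)

Lemma maxr_vlattice (R : realType) : 
  vlattice (fun x y : R^o => Num.max (x : R) (y : R) : R^o).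
Proof.
split.
- exact: maxxx.
- exact: maxC.
- exact: maxA.
- by move=> x y z; rewrite addr_maxl.
- by move=> a x y a0; rewrite -[RHS]/(a * Num.max x y) maxr_pMr.
Qed.

Section L1.
Context d (T : measurableType d) (R : realType).
Variable mu : {measure set T -> \bar R}.
Implicit Types f g : T -> R^o.

Definition L1max f g : T -> R^o := fun t => Num.max (f t) (g t).
Definition L1dom : set (T -> R^o) := 
  [set f : T -> R^o | mu.-integrable setT (EFin \o (f : T -> R))].
Definition L1norm f : R := fine (\int[mu]_t `|(f t)%:E|)%E.

Lemma L1dom_meas f : L1dom f -> measurable_fun [set: T] (f : T -> R).
Proof. by move=> /measurable_int /measurable_EFinP. Qed.

Lemma L1dom_meas_abs f : measurable_fun [set: T] (f : T -> R) ->
  measurable_fun [set: T] (fun t => `|(f t)%:E|)%E.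
Proof. by move=> mf; apply: measurableT_comp => //; exact/measurable_EFinP. Qed.

Lemma L1normE f : L1dom f -> ((L1norm f)%:E = \int[mu]_t `|(f t)%:E|)%E.
Proof.
move=> Df; rewrite /L1norm fineK//.
exact: integrable_fin_num (integrable_abse Df).
Qed.

Lemma L1norm_eq0 f : L1dom f -> L1norm f = 0 <-> (f = cst 0 %[ae mu]).
Proof.
move=> Df; have mf : measurable_fun [set: T] (EFin \o f) by exact: measurable_int Df.
have := ae_eq_integral_abs mu measurableT mf.
have -> : (\int[mu]_(x in setT) `|(EFin \o f) x| = (L1norm f)%:E)%E by rewrite L1normE.
move=> [h1 h2]; split=> [f0|f0].
  have /h1 : ((L1norm f)%:E = 0)%E by rewrite f0.
  by apply: filterS => t /= /[apply] -[].
apply: EFin_inj; apply: h2; apply: filterS f0 => t /= ft _.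
by have /= -> := ft I.
Qed.

Lemma L1_sl : seminormed_lattice L1max L1dom L1norm.
Proof.
have Dlin (a : R) f g : L1dom f -> L1dom g -> L1dom (a *: f + g).
  move=> Df Dg; rewrite /L1dom /=.
  have -> : EFin \o (a *: f + g) = ((fun t => a%:E * (EFin \o f) t) \+ (EFin \o g))%E.
    by apply/funext => t; rewrite /= EFinD EFinM.
  by apply: integrableD => //; exact: integrableZl.
have D0 : L1dom 0.
  rewrite /L1dom /=; have -> : EFin \o (0 : T -> R^o) = cst 0%E by [].
  exact: integrable0.
have DZ (a : R) f : L1dom f -> L1dom (a *: f).
  by move=> Df; rewrite -[_ *: _]addr0; exact: Dlin.
have DD f g : L1dom f -> L1dom g -> L1dom (f + g).
  by move=> Df Dg; rewrite -[f]scale1r; exact: Dlin.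
split=> //.
- exact: fun_vlattice (maxr_vlattice R).
- move=> f g Df Dg.
  have Dfg : L1dom ((fun t => `|f t|) + (fun t => `|g t|)).
    by apply: DD; exact: (integrable_abse (f := EFin \o _)).
  apply: le_integrable Dfg => //.
    by apply/measurable_EFinP; apply: measurable_maxr; exact: L1dom_meas.
  move=> t _ /=; rewrite lee_fin /L1max [leRHS]ger0_norm ?addr_ge0//.
  case: (leP (f t) (g t)) => _; first by rewrite lerDr.
  by rewrite lerDl.
- move=> f g Df Dg; have Dfg := DD _ _ Df Dg.
  have mf := L1dom_meas Df; have mg := L1dom_meas Dg.
  rewrite -lee_fin EFinD !L1normE// -ge0_integralD//; try exact: L1dom_meas_abs.
  apply: ge0_le_integral => //.
  + exact/L1dom_meas_abs/L1dom_meas.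
  + by apply: emeasurable_funD; exact: L1dom_meas_abs.
  + by move=> t _; rewrite /= -EFinD lee_fin; exact: ler_normD.
- move=> a f Df; apply: EFin_inj; rewrite EFinM !L1normE//; last exact: DZ.
  rewrite -ge0_integralZl//; last exact/L1dom_meas_abs/L1dom_meas.
  by apply: eq_integral => t _ /=; rewrite -EFinM -normrM.
- move=> f g Df Dg fg; rewrite -lee_fin !L1normE//; apply: ge0_le_integral => //.
  + exact/L1dom_meas_abs/L1dom_meas.
  + exact/L1dom_meas_abs/L1dom_meas.
  + move=> t _; rewrite lee_fin; have := congr1 (@^~ t) fg.
    rewrite /vabs /L1max /= => /max_idPr.
    have E (x : R) : Num.max x (- x) = `|x|.
      case: (leP 0 x) => x0; first by rewrite ger0_norm// max_l//; lra.
      by rewrite ltr0_norm// max_r//; lra.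
    by rewrite !E.
Qed.

(** Riesz-Fischer: the absolute values of the increments have an integrable sum [g], so that [u n]
    converges almost everywhere, dominated by [g] plus the absolute value of [u 0]. *)
Lemma L1_complete (u : nat -> T -> R^o) : (forall n, L1dom (u n)) ->
  (forall n, L1norm (u n.+1 - u n) <= 2^-1 ^+ n) ->
  exists2 l, L1dom l & L1norm (u n - l) @[n --> \oo] --> 0.
Proof.
move=> Du hu; pose v n := u n.+1 - u n.
have Dv n : L1dom (v n) by apply: (sl_DB L1_sl); exact: Du.
have mv n : measurable_fun [set: T] (fun t => `|(v n t)%:E|)%E.
  exact/L1dom_meas_abs/L1dom_meas.
have mu_ n : measurable_fun [set: T] (u n : T -> R) by exact: L1dom_meas (Du n).
pose g t := (\sum_(0 <= n <oo) `|(v n t)%:E|)%E.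
have g0 t : (0 <= g t)%E by apply: nneseries_ge0.
have mg : measurable_fun [set: T] g by exact: ge0_emeasurable_sum.
have intg : (\int[mu]_t g t <= 2%:E)%E.
  rewrite integral_nneseries//; apply: lime_le.
    by apply: is_cvg_nneseries => n _ _; exact: integral_ge0.
  apply: nearW => n; apply: le_trans (_ : ((2 * (1 - 2^-1 ^+ n))%:E <= _)%E).
    elim: n => [|n IH]; first by rewrite big_geq// expr0 subrr mulr0.
    have vn : (\int[mu]_t `|(v n t)%:E| <= (2^-1 ^+ n)%:E)%E.
      by rewrite -L1normE ?lee_fin; [exact: hu|exact: Dv].
    rewrite big_nat_recr//=; apply: le_trans (leeD IH vn) _.
    rewrite -EFinD lee_fin exprS; set x : R := 2^-1 ^+ n; lra.
  rewrite lee_fin; have : 0 <= 2^-1 ^+ n :> R by rewrite exprn_ge0.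
  lra.
have Ig : mu.-integrable setT g.
  apply/integrableP; split => //.
  under eq_integral do rewrite gee0_abs//.
  exact: le_lt_trans intg (ltry _).
have fing : \forall t \ae mu, g t \is a fin_num.
  by apply: filterS (integrable_ae measurableT Ig) => t; exact.
pose G := [set t | (g t < +oo)%E].
have mG : measurable G.
  by rewrite -[G]setTI; exact: emeasurable_fun_infty_o.
have cvgG t : G t -> cvgn (fun n => u n t : R).
  move=> Gt.
  have : cvgn (series (fun n => v n t : R)).
    apply: normed_cvg; apply: nondecreasing_is_cvgn.
      by apply: nondecreasing_series => n _ _; exact: normr_ge0.
    exists (fine (g t)) => _ [n _ <-].
    rewrite -lee_fin fineK; last by rewrite ge0_fin_numE.
    have := @nneseries_lim_ge R (fun n => `|(v n t)%:E|)%E xpredT 0 n.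
    move=> /(_ (fun _ _ _ => abse_ge0 _)); apply: le_trans.
    by rewrite /series /= sumEFin.
  have -> : series (fun n => v n t : R) = (fun n => u n t - u 0%N t : R).
    by rewrite -[RHS](telescopeK (fun n => u n t : R)).
  move=> /cvg_ex[a ua]; apply/cvg_ex; exists (a + u 0%N t).
  have -> : (fun n => u n t : R) = (fun n => (u n t - u 0%N t) + u 0%N t).
    by apply/funext => n; rewrite subrK.
  by apply: cvgD ua _; exact: cvg_cst.
(* Off the set [G], which has full measure, the sequence is replaced by [0]: it then converges
   everywhere, and its limit is measurable. *)
pose w n t : R := u n t * \1_G t.
pose l t : R := lim (w n t @[n --> \oo]).
have wl t : w n t @[n --> \oo] --> l t.
  suff : cvgn (w ^~ t) by [].
  rewrite /w indicE; case: (boolP (t \in G)) => tG.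
    have -> : (fun n => u n t * true%:R : R) = (fun n => u n t : R).
      by apply/funext => n; rewrite mulr1.
    by apply: cvgG; rewrite inE in tG.
  have -> : (fun n => u n t * false%:R : R) = (fun=> 0).
    by apply/funext => n; rewrite mulr0.
  exact: is_cvg_cst.
have ml : measurable_fun [set: T] l.
  apply: (measurable_fun_cvg (h := w)) => // n.
  by apply: measurable_funM => //; exact: measurable_indic.
have ae_wu : \forall t \ae mu, forall n, w n t = u n t.
  apply: filterS fing => t gt n; rewrite /w indicE mem_set ?mulr1//.
  by rewrite /G /= -ge0_fin_numE.
pose h t := (`|(u 0%N t)%:E| + g t)%E.
have Ih : mu.-integrable setT h.
  by apply: integrableD => //; apply: integrable_abse; exact: Du.
have le_h n t : (`|(u n t)%:E| <= h t)%E.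
  have := @nneseries_lim_ge R (fun n => `|(v n t)%:E|)%E xpredT 0 n.
  move=> /(_ (fun _ _ _ => abse_ge0 _)) vg.
  apply: le_trans (_ : (`|(u 0%N t)%:E| + \sum_(0 <= i < n) `|(v i t)%:E| <= _)%E); last first.
    by rewrite /h leeD2l.
  elim: (n) => [|m IH]; first by rewrite big_geq// adde0.
  rewrite big_nat_recr//= addeA.
  apply: le_trans (_ : (`|(u m t)%:E| + `|(v m t)%:E| <= _)%E); last first.
    by rewrite leeD2r.
  rewrite /= -EFinD lee_fin.
  have -> : u m.+1 t = u m t + v m t by rewrite -[LHS](subrK (u m t)) addrC.
  exact: ler_normD.
have [|||||Dl cvg0 _] := @dominated_convergence _ _ R mu setT measurableT
    (fun n => EFin \o u n) (EFin \o l) h.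
- by move=> n; exact/measurable_EFinP.
- exact/measurable_EFinP.
- apply: filterS ae_wu => t wu _; apply: cvg_EFin; first exact: nearW.
  have -> : fine \o (fun n => (EFin \o u n) t) = w ^~ t.
    by apply/funext => n /=; rewrite wu.
  exact: wl.
- exact: Ih.
- by apply: nearW => t n _; exact: le_h.
exists l => //; move: cvg0.
have -> : [sequence (\int[mu]_(x in setT) `|(EFin \o u n) x - (EFin \o l) x|)%E]_n
    = (fun n => (L1norm (u n - l))%:E).
  apply/funext => n /=; rewrite L1normE; first by apply: eq_integral.
  by apply: (sl_DB L1_sl) => //; exact: Du.
by move=> /fine_cvgP[_].
Qed.

Definition L1cs : cslat R := CSLat L1_sl L1_complete.

End L1.

(** * The spaces [L_1(mu)] and their additivity *)

Section LspaceFacts.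
Context d (T : measurableType d) (R : realType).
Variable mu : {measure set T -> \bar R}.
Local Notation L1s := (LspaceType1 mu).

Lemma Lspace_meas (g : L1s) : measurable_fun [set: T] (g : T -> R).
Proof. exact: measurable_funPT (repr (LebesgueSpace.sort g)). Qed.

Lemma Lspace_dom (g : L1s) : L1dom mu (g : T -> R).
Proof.
apply/integrableP; split; first exact/measurable_EFinP/Lspace_meas.
have := @Lebesgue_finite _ _ _ _ _ _ g.
by rewrite /finite_norm Lnorm1.
Qed.

Lemma Lspace_ext (f g : L1s) : (f : T -> R) = (g : T -> R) %[ae mu] -> f = g.
Proof.
move=> fg; have : LebesgueSpace.sort f = LebesgueSpace.sort g.
  have := introT (ae_eqP (LebesgueSpace.sort f) (LebesgueSpace.sort g)) fg.
  by move=> /eqP; rewrite /= !reprK.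
case: f g fg => [f [[pf]]] [g [[pg]]] _ /= fg; subst g.
by rewrite (Prop_irrelevance pf pg).
Qed.

Lemma Lspace_exists (f : T -> R) : L1dom mu f ->
  exists g : L1s, (g : T -> R) = f %[ae mu].
Proof.
move=> Df; have mf := L1dom_meas Df.
pose F : {mfun T >-> measurableTypeR R} :=
  HB.pack f (isMeasurableFun.Build _ _ T (measurableTypeR R) f mf).
pose q : {mfun_ mu, T >-> measurableTypeR R} := \pi_({mfun_ mu, T >-> measurableTypeR R})%qT F.
have qf : (q : T -> R) = f %[ae mu].
  have : (\pi_({mfun_ mu, T >-> measurableTypeR R}) (repr q) =
          \pi_({mfun_ mu, T >-> measurableTypeR R}) F)%qT by rewrite reprK.
  by move=> /eqP; rewrite eqmodE => /asboolP.
have mq : measurable_fun [set: T] (q : T -> R) by exact: measurable_funPT (repr q).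
have fin : finite_norm mu 1 (q : T -> R).
  rewrite /finite_norm Lnorm1.
  rewrite (ae_eq_integral (fun t => `|(f t)%:E|)%E)//; try exact: L1dom_meas_abs.
    by have /integrableP[] := Df.
  rewrite /ae_eq; apply: filterS qf => t /= qt tT; by rewrite (qt tT).
pose g : L1s := HB.pack q (isFinLebesgue.Build d T R mu 1%E (lexx _) q fin).
by exists g.
Qed.

Lemma L1norm_ae (f g : T -> R) : L1dom mu f -> L1dom mu g ->
  f = g %[ae mu] -> L1norm mu f = L1norm mu g.
Proof.
move=> Df Dg fg; congr fine.
apply: ae_eq_integral => //.
- exact: L1dom_meas_abs (L1dom_meas Df).
- exact: L1dom_meas_abs (L1dom_meas Dg).
rewrite /ae_eq; apply: filterS fg => t /= fgt tT.
by rewrite (fgt tT).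
Qed.

Lemma is_L1_quot : is_L1 (quotBL (L1cs mu)).
Proof.
have sL := L1_sl mu.
have cls_ae (f g : T -> R) : L1dom mu f -> L1dom mu g ->
    @cls _ (L1cs mu) f = @cls _ (L1cs mu) g <-> f = g %[ae mu].
  move=> Df Dg; rewrite (@cls_eqP _ (L1cs mu)) // L1norm_eq0; last exact: (sl_DB sL).
  split; apply: filterS => t /= h tT; have {h} := h tT.
    by move=> /eqP; rewrite subr_eq0 => /eqP.
  by move=> e; apply/eqP; rewrite subr_eq0; apply/eqP.
have H (f g : T -> R) : L1dom mu f -> L1dom mu g -> f = g %[ae mu] ->
    @cls _ (L1cs mu) f = @cls _ (L1cs mu) g.
  by move=> Df Dg; move/(cls_ae _ _ Df Dg).
exists d, T, mu, (fun f : L1s => @cls _ (L1cs mu) (f : T -> R)); split.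
- rewrite -setTT_bijective; split=> // [f g _ _|q _].
    by move=> /(cls_ae _ _ (Lspace_dom f) (Lspace_dom g)); exact: Lspace_ext.
  have [f Df ->] := clsW q; have [g gf] := Lspace_exists Df.
  exists g => //; apply: H => //; exact: Lspace_dom.
- move=> a f g h hfg; rewrite -cls_lin; [|exact: Lspace_dom|exact: Lspace_dom].
  apply: H => //; first exact: Lspace_dom.
  by apply: (sl_Dlin sL); exact: Lspace_dom.
- move=> f g h hfg; rewrite -cls_lat_join; [|exact: Lspace_dom|exact: Lspace_dom].
  apply: H => //; first exact: Lspace_dom.
  by apply: (sl_Dj sL); exact: Lspace_dom.
- move=> f g h hfg.
  have Df := Lspace_dom f; have Dg := Lspace_dom g.
  have -> : lat_meet (@cls _ (L1cs mu) (f : T -> R)) (@cls _ (L1cs mu) (g : T -> R)) =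
      @cls _ (L1cs mu) ((f : T -> R^o) + (g : T -> R^o) - L1max (f : T -> R) (g : T -> R)).
    rewrite lat_meetE /vmeet -(@cls_lat_join _ (L1cs mu) _ _ Df Dg).
    rewrite (@cls_add _ (L1cs mu) _ _ Df Dg).
    exact: (@clsB _ (L1cs mu) _ _ (sl_DD sL Df Dg) (sl_Dj sL Df Dg)).
  apply: H; first exact: Lspace_dom.
    apply: (sl_DB sL); last exact: (sl_Dj sL).
    exact: (sl_DD sL).
  apply: filterS hfg => t /= h' tT; rewrite (h' tT).
  have minE (a b : R) : Num.min a b = a + b - Num.max a b.
    by rewrite -(addr_max_min a b) addrAC subrr add0r.
  exact: minE.
- move=> f; rewrite norm_cls; last exact: Lspace_dom.
  by rewrite Lnorm1 -L1normE//; exact: Lspace_dom.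
Qed.

(** Positivity in [X] is read on representatives: [J f] is positive when [f] is almost everywhere
    its maximum with a representative [z] of [0]. For such functions the integrals of the absolute
    values add up. *)
Lemma L1_isometry_AL_space (X : banachLatticeType R) (J : L1s -> X) :
  L1_lattice_isometry J -> AL_space X.
Proof.
move=> [[J' JK J'K] Jl Jj _ JN]; have sL := L1_sl mu.
have Ji : injective J by exact: can_inj JK.
have JN' (f : L1s) : `|J f| = L1norm mu (f : T -> R).
  by apply: EFin_inj; rewrite JN Lnorm1 L1normE//; exact: Lspace_dom.
have [z zP] := Lspace_exists (sl_D0 sL).
have Jz : J z = 0.
  have := Jl (-1) z z z; rewrite scaleN1r addNr; apply.
  by apply: filterS zP => t /= h tT; rewrite (h tT) /= mulN1r addNr.
have pos (f : L1s) : vle lat_join 0 (J f) ->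
    \forall t \ae mu, 0 <= (f : T -> R) t.
  rewrite -Jz => zf.
  have [h hP] := Lspace_exists (sl_Dj sL (Lspace_dom z) (Lspace_dom f)).
  have /Ji hf : J h = J f by rewrite (Jj z f h).
  move: hP; rewrite hf => hP.
  apply: filterS2 hP zP => t ht zt; rewrite (ht I) /L1max (zt I) /=.
  by rewrite le_max lexx.
move=> x y; rewrite -(J'K x) -(J'K y); set f := J' x; set g := J' y.
move=> /pos f0 /pos g0.
have Df := Lspace_dom f; have Dg := Lspace_dom g.
have Dfg := sl_DD sL Df Dg.
have [s sP] := Lspace_exists Dfg.
have <- : J s = J f + J g.
  rewrite (Jl 1 f g s) ?scale1r//.
  by apply: filterS sP => t /= h tT; rewrite (h tT) mul1r.
rewrite !JN' (L1norm_ae (Lspace_dom s) Dfg sP).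
apply: EFin_inj; rewrite EFinD !L1normE// -ge0_integralD//;
  try exact/L1dom_meas_abs/Lspace_meas.
apply: ae_eq_integral => //.
- exact: L1dom_meas_abs (L1dom_meas Dfg).
- by apply: emeasurable_funD; exact/L1dom_meas_abs/Lspace_meas.
- apply: filterS2 f0 g0 => t ft gt _ /=.
  by rewrite -EFinD !ger0_norm// addr_ge0.
Qed.

End LspaceFacts.

Lemma is_L1_AL_space (R : realType) (X : banachLatticeType R) :
  is_L1 X -> AL_space X.
Proof. by move=> [d [T [mu [J]]]]; exact: L1_isometry_AL_space. Qed.

Lemma L1_dominated d (T : measurableType d) (R : realType)
    (mu : {measure set T -> \bar R}) (f_ : nat -> T -> R^o) (f h : T -> R^o) :
  (forall n, measurable_fun [set: T] (f_ n : T -> R)) ->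
  (forall t, (f_ n t : R) @[n --> \oo] --> (f t : R)) ->
  L1dom mu h -> (forall n t, `|f_ n t| <= h t) ->
  [/\ L1dom mu f, forall n, L1dom mu (f_ n) &
      forall e : R, 0 < e -> exists n, L1norm mu (f - f_ n) < e].
Proof.
move=> mf_ f_f Dh f_h; have sL := L1_sl mu.
have mf : measurable_fun [set: T] (f : T -> R).
  exact: (@measurable_fun_cvg _ _ _ _ (fun n => f_ n : T -> R)).
have [|||||Df cvg0 _] := @dominated_convergence _ _ R mu setT measurableT
    (fun n => EFin \o (f_ n : T -> R)) (EFin \o (f : T -> R)) (EFin \o (h : T -> R)).
- by move=> n; exact/measurable_EFinP.
- exact/measurable_EFinP.
- apply: nearW => t _; apply: cvg_EFin; [exact: nearW|exact: f_f].
- exact: Dh.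
- by apply: nearW => t n _; rewrite /= lee_fin; exact: f_h.
have Df_ n : L1dom mu (f_ n).
  apply: le_integrable Dh => //; first exact/measurable_EFinP.
  move=> t _ /=; rewrite lee_fin; apply: le_trans (f_h n t) _; exact: ler_norm.
split=> // e e0; move: cvg0.
have -> : [sequence (\int[mu]_(x in setT) `|(EFin \o (f_ n : T -> R)) x
    - (EFin \o (f : T -> R)) x|)%E]_n = (fun n => (L1norm mu (f_ n - f))%:E).
  apply/funext => n /=; rewrite L1normE; first by apply: eq_integral.
  exact: (sl_DB sL).
move=> /fine_cvgP[_ /= cvg0].
have [n _] := cvg0_ex 0 cvg0 e0; rewrite (sl_NB sL)// => nf; exists n.
by apply: le_lt_trans nf; exact: ler_norm.
Qed.

(** * [L_1] of the Lebesgue measure: intervals and separability *)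

Section Lebesgue.
Context (R : realType).
Let mu := @lebesgue_measure R.
Let sL := L1_sl mu.
Local Notation S := (quotBL (L1cs mu)).
Local Notation cl := (@cls R (L1cs mu)).

(** Half-open, so that adjacent intervals are disjoint with an interval as union, and the identities
    between classes already hold pointwise. *)
Definition itvfun (a b : R) : R -> R^o := fun t => \1_(`[a, b[%classic) t.

Lemma itvfunE (a b t : R) : itvfun a b t = (a <= t < b)%R%:R.
Proof. by rewrite /itvfun indicE mem_setE in_itv. Qed.

Lemma integral_itvfun (a b : R) :
  (\int[mu]_t (itvfun a b t)%:E = lebesgue_measure (`[a, b[%classic : set R))%E.
Proof.
have mI : measurable (`[a, b[%classic : set (measurableTypeR R)).
  exact: measurable_itv.
by have := integral_indic mu measurableT mI; rewrite setIT.
Qed.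

Lemma itvfun_dom (a b : R) : L1dom mu (itvfun a b).
Proof.
apply/integrableP; split.
  by apply/measurable_EFinP; exact: measurable_indic.
under eq_integral do rewrite /= ger0_norm//.
rewrite integral_itvfun lebesgue_measure_itv /= lte_fin.
by case: ifP => _; rewrite ?ltry// -EFinB ltry.
Qed.

Lemma L1norm_itvfun (a b : R) : a <= b -> L1norm mu (itvfun a b) = b - a.
Proof.
move=> ab; apply: EFin_inj; rewrite L1normE; last exact: itvfun_dom.
under eq_integral do rewrite /= ger0_norm//.
rewrite integral_itvfun lebesgue_measure_itv /= lte_fin.
by case: ltgtP ab => // -> _; rewrite subrr.
Qed.

Definition itvcls (a b : R) : S := cl (itvfun a b).

Lemma itvcls_ge0 a b : vle lat_join 0 (itvcls a b).
Proof.
rewrite /vle -[0 in LHS]/(cl 0) -(@cls_lat_join _ (L1cs mu)).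
- congr cls; apply/funext => t; rewrite /= /L1max itvfunE.
  by apply/max_idPr.
- exact: sl_D0 sL.
- exact: itvfun_dom.
Qed.

Lemma itvclsD a b c : a <= b -> b <= c -> itvcls a c = itvcls a b + itvcls b c.
Proof.
move=> ab bc; rewrite /itvcls (@cls_add _ (L1cs mu)); try exact: itvfun_dom.
congr cls; apply/funext => t.
rewrite -[RHS]/(itvfun a b t + itvfun b c t) !itvfunE.
case: (leP b t) => bt; first by rewrite andbF add0r (le_trans ab bt).
by rewrite andbT addr0 (lt_le_trans bt bc) andbT.
Qed.

Lemma itvcls_disj a b c : a <= b -> b <= c ->
  vmeet lat_join (itvcls a b) (itvcls b c) = 0.
Proof.
move=> ab bc; have D1 := itvfun_dom a b; have D2 := itvfun_dom b c.
rewrite /vmeet -(@cls_lat_join _ (L1cs mu) _ _ D1 D2).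
rewrite (@cls_add _ (L1cs mu) _ _ D1 D2).
rewrite (@clsB _ (L1cs mu) _ _ (sl_DD sL D1 D2) (sl_Dj sL D1 D2)).
rewrite -[RHS]/(cl 0); congr cls; apply/funext => t.
rewrite -[LHS]/(itvfun a b t + itvfun b c t - Num.max (itvfun a b t) (itvfun b c t)).
rewrite !itvfunE; case: (leP b t) => bt.
  by rewrite andbF add0r max_r// subrr.
by rewrite andbT addr0 max_l// subrr.
Qed.

Lemma norm_itvcls a b : a <= b -> `|itvcls a b| = b - a.
Proof.
move=> ab; rewrite /itvcls (@norm_cls _ (L1cs mu) _ (itvfun_dom a b)).
exact: L1norm_itvfun.
Qed.

Definition stepfun (s : seq (R * (R * R))) : R -> R^o :=
  fun t => \sum_(i <- s) i.1 * itvfun i.2.1 i.2.2 t.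

Lemma stepfun_dom s : L1dom mu (stepfun s).
Proof.
elim: s => [|i s IH].
  have -> : stepfun [::] = 0 by apply/funext => t; rewrite /stepfun big_nil.
  exact: sl_D0 sL.
have -> : stepfun (i :: s) = i.1 *: itvfun i.2.1 i.2.2 + stepfun s.
  by apply/funext => t; rewrite /stepfun big_cons.
by apply: (sl_Dlin sL) => //; exact: itvfun_dom.
Qed.

Definition ratstep (s : seq (rat * (rat * rat))) : R -> R^o :=
  stepfun [seq (ratr i.1, (ratr i.2.1, ratr i.2.2)) | i <- s].

Definition rat_approx (f : R -> R^o) := L1dom mu f /\
  forall e : R, 0 < e -> exists s, L1norm mu (f - ratstep s) < e.

Lemma rat_approx_closed f : L1dom mu f ->
  (forall e : R, 0 < e -> exists2 g, rat_approx g & L1norm mu (f - g) < e) ->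
  rat_approx f.
Proof.
move=> Df h; split=> // e e0; have e2 : 0 < e / 2 by rewrite divr_gt0.
have [g [Dg gr] fg] := h _ e2; have [s gs] := gr _ e2; exists s.
apply: le_lt_trans (sl_Ntri sL Df Dg (stepfun_dom _)) _.
by rewrite [ltRHS]splitr ltrD.
Qed.

Lemma rat_approxD f g : rat_approx f -> rat_approx g -> rat_approx (f + g).
Proof.
move=> [Df fr] [Dg gr]; split; first exact: (sl_DD sL).
move=> e e0; have e2 : 0 < e / 2 by rewrite divr_gt0.
have [s fs] := fr _ e2; have [s' gs] := gr _ e2; exists (s ++ s').
have -> : ratstep (s ++ s') = ratstep s + ratstep s'.
  by apply/funext => t; rewrite /ratstep /stepfun map_cat big_cat.
rewrite opprD addrACA.
have D1 := sl_DB sL Df (stepfun_dom [seq (ratr i.1, (ratr i.2.1, ratr i.2.2)) | i <- s]).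
have D2 := sl_DB sL Dg (stepfun_dom [seq (ratr i.1, (ratr i.2.1, ratr i.2.2)) | i <- s']).
by apply: le_lt_trans (sl_ND sL D1 D2) _; rewrite [ltRHS]splitr ltrD.
Qed.

Lemma rat_approx_itv (r : R) (a b : rat) : a <= b ->
  rat_approx (r *: itvfun (ratr a) (ratr b)).
Proof.
move=> ab; have Di := itvfun_dom (ratr a) (ratr b).
split; first exact: (sl_DZ sL).
(* Adding 1 to the length keeps [m] positive when [a = b]. *)
move=> e e0; pose m : R := 1 + (ratr b - ratr a).
have ab' : ratr a <= ratr b :> R by rewrite ler_rat.
have m0 : 0 < m by rewrite ltr_wpDr// subr_ge0.
have [q rq] : exists q : rat, `|r - ratr q| < e / m.
  have [||x [xr [q _ qx]]] := @dense_rat R (ball r (e / m)).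
  - by exists r; apply: ballxx; rewrite divr_gt0.
  - exact: ball_open.
  - by exists q; move: xr; rewrite -ball_normE /= -qx.
exists [:: (q, (a, b))].
have -> : r *: itvfun (ratr a) (ratr b) - ratstep [:: (q, (a, b))] =
    (r - ratr q) *: itvfun (ratr a) (ratr b).
  apply/funext => t; rewrite scalerBl; congr (_ - _).
  by rewrite /ratstep /stepfun /= big_seq1.
rewrite (sl_NZ sL)// L1norm_itvfun//.
apply: le_lt_trans (_ : `|r - ratr q| * m < _).
  by rewrite ler_wpM2l// lerDr.
by rewrite -ltr_pdivlMr.
Qed.

(** The half-open steps do not overlap, so that at most one summand is nonzero at [t]. *)
Lemma itvfun_stairs (a h : R) (c : nat -> R) (n : nat) (t : R) : 0 < h ->
  let s := \sum_(i < n) c i * itvfun (a + i%:R * h) (a + i.+1%:R * h) t in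
  if a <= t < a + n%:R * h then
    exists i, [/\ a + i%:R * h <= t, t < a + i.+1%:R * h, (i < n)%N & s = c i]
  else s = 0.
Proof.
move=> h0; elim: n => [|n IH] /=.
  by rewrite big_ord0 mul0r addr0; case: (leP a t).
move: IH => /=; rewrite big_ord_recr /=; set s := \sum_(i < n) _.
have nS : a + n%:R * h <= a + n.+1%:R * h.
  by rewrite lerD2l ler_pM2r// ler_nat.
have an : a <= a + n%:R * h by rewrite lerDl mulr_ge0// ltW.
rewrite itvfunE; case: (leP a t) => at_ /=; last first.
  move=> ->; case: (leP (a + n%:R * h) t) => nt; last by rewrite mulr0 addr0.
  by have := lt_le_trans at_ (le_trans an nt); rewrite ltxx.
case: (ltP t (a + n%:R * h)) => tn.
  move=> [i [i1 i2 i3 ->]]; rewrite (lt_le_trans tn nS); exists i.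
  by rewrite mulr0 addr0; split=> //; exact: ltnW.
move=> ->; rewrite add0r; case: ltP => tn1 /=; last by rewrite mulr0.
by exists n; rewrite mulr1.
Qed.

(** Staircases taking the values of [g] at the left endpoints of a rational grid converge pointwise
    by continuity; the maximum of the absolute value of [g] on the interval dominates them. *)
Lemma rat_approx_continuous (g : R -> R) (N : nat) : continuous g ->
  rat_approx (fun t => g t * itvfun (- N%:R) N%:R t : R^o).
Proof.
move=> cg; pose h k : R := k.+1%:R^-1.
have h0 k : 0 < h k by rewrite invr_gt0.
(* The number of steps of width [h k] that fill the interval from [- N%:R] to [N%:R]. *)
pose M k := (2 * N * k.+1)%N.
have endE k : - N%:R + (M k)%:R * h k = N%:R :> R.
  by rewrite /M /h natrM mulfK// natrM mulr_natl mulr2n addrA addNr add0r.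
pose s k : R -> R^o := fun t => \sum_(i < M k) g (- N%:R + i%:R * h k) *
  itvfun (- N%:R + i%:R * h k) (- N%:R + i.+1%:R * h k) t.
have sP k t := itvfun_stairs (- N%:R) (fun i => g (- N%:R + i%:R * h k)) (M k) t (h0 k).
have NN : - N%:R <= N%:R :> R by rewrite (@le_trans _ _ 0) ?oppr_le0.
have [C gC] : exists C, forall t, - N%:R <= t <= N%:R -> `|g t| <= C.
  have [|c _ hc] := @EVT_max R (fun t => `|g t|) _ _ NN.
    apply: continuous_subspaceT => t.
    exact: (continuous_comp (cg t) (@norm_continuous _ _ _)).
  by exists `|g c| => t tN; apply: hc; rewrite in_itv.
have srat k : rat_approx (s k).
  have rE (i : nat) : - N%:R + i%:R * h k = ratr (- N%:R + i%:R / k.+1%:R) :> R.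
    by rewrite rmorphD /= rmorphM /= fmorphV /= rmorphN /= !ratr_nat.
  rewrite /s; elim: (M k) => [|n IH].
    have -> : (fun t => \sum_(i < 0) g (- N%:R + i%:R * h k) *
        itvfun (- N%:R + i%:R * h k) (- N%:R + i.+1%:R * h k) t) = (0 : R -> R^o).
      by apply/funext => t; rewrite big_ord0.
    split; first exact: sl_D0 sL.
    move=> e e0; exists [::]; have -> : 0 - ratstep [::] = 0.
      by apply/funext => t; rewrite sub0r /ratstep /stepfun /= -[LHS]/(- _) big_nil oppr0.
    by rewrite (sl_N0 sL).
  set F : R -> R^o := fun t => _ in IH *; set F' : R -> R^o := fun t => _.
  have -> : F' = F + g (- N%:R + n%:R * h k) *:
      itvfun (- N%:R + n%:R * h k) (- N%:R + n.+1%:R * h k).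
    by apply/funext => t; rewrite /F' big_ord_recr.
  apply: rat_approxD => //; rewrite !rE; apply: rat_approx_itv.
  by rewrite lerD2l ler_pM2r ?invr_gt0// ler_nat.
have in_grid k t : - N%:R <= t < N%:R ->
    exists p, [/\ - N%:R <= p <= N%:R, `|t - p| <= h k & s k t = g p].
  move=> tN; have := sP k t; rewrite endE tN => -[i [i1 i2 i3 si]].
  exists (- N%:R + i%:R * h k); split=> //.
    rewrite lerDl mulr_ge0 ?(ltW (h0 k))//=.
    by move/andP: tN => [_ /ltW]; exact: le_trans.
  rewrite ger0_norm ?subr_ge0// lerBlDl; apply/ltW.
  by move: i2; rewrite -natr1 mulrDl mul1r addrA.
have out_grid k t : (- N%:R <= t < N%:R) = false -> s k t = 0.
  by move=> tN; have := sP k t; rewrite endE tN.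
have [] := @L1_dominated _ _ R mu s (fun t => g t * itvfun (- N%:R) N%:R t)
    (C *: itvfun (- N%:R) N%:R).
- by move=> k; apply: (@L1dom_meas _ _ _ mu); exact: (srat k).1.
- move=> t; rewrite itvfunE; case: (boolP (- N%:R <= t < N%:R)) => tN; last first.
    rewrite mulr0; have -> : (fun n => s n t : R) = (fun=> 0).
      by apply/funext => k; apply: out_grid; exact: negbTE.
    exact: cvg_cst.
  rewrite mulr1; apply/cvgrPdist_lt => e e0.
  have /cvgrPdist_lt/(_ _ e0)/nbhs_ballP[/= del del0 hdel] := cg t.
  have hk : \forall k \near \oo, h k < del.
    have /cvgr0Pnorm_lt/(_ _ del0) := @cvg_harmonic R.
    by apply: filterS => k; rewrite ger0_norm ?ltW.
  apply: filterS hk => k hk; have [p [_ tp ->]] := in_grid k t tN.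
  by apply: hdel; rewrite -ball_normE /=; exact: le_lt_trans hk.
- by apply: (sl_DZ sL); exact: itvfun_dom.
- move=> k t; rewrite -[leRHS]/(C * itvfun _ _ t) itvfunE.
  case: (boolP (- N%:R <= t < N%:R)) => tN; last first.
    by rewrite mulr0 out_grid ?normr0//; exact: negbTE.
  by rewrite mulr1; have [p [pN _ ->]] := in_grid k t tN; exact: gC.
move=> Dg Ds lims; apply: rat_approx_closed => // e e0.
by have [k ke] := lims e e0; exists (s k).
Qed.

(** Truncation to bounded intervals comes first, because the approximation by continuous functions
    is applied on a set of finite measure. *)
Lemma rat_approx_all f : L1dom mu f -> rat_approx f.
Proof.
move=> Df; have mf := L1dom_meas Df.
pose F N : R -> R^o := fun t => f t * itvfun (- N%:R) N%:R t.
have itv_le1 (a b t : R) : 0 <= itvfun a b t <= 1.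
  by rewrite itvfunE ler0n /= lern1 leq_b1.
have [||||_ DF limF] := @L1_dominated _ _ R mu F f (fun t => `|f t|).
- move=> N; apply: measurable_funM => //; exact: L1dom_meas (itvfun_dom _ _).
- move=> t; apply/cvgrPdist_lt => e e0.
  have tN : \forall N \near \oo, `|t| < N%:R :> R.
    exists (Num.truncn `|t|).+1 => // n /= tn.
    by apply: lt_le_trans (truncnS_gt _) _; rewrite ler_nat.
  apply: filterS tN => N; rewrite ltr_norml => /andP[t1 t2].
  by rewrite /F itvfunE (ltW t1) t2 mulr1 subrr normr0.
- exact: (integrable_abse (f := EFin \o _)) Df.
- move=> N t; rewrite /F normrM -[leRHS]mulr1 ler_wpM2l//.
  by have /andP[? ?] := itv_le1 (- N%:R) N%:R t; rewrite ger0_norm.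
apply: rat_approx_closed => // e e0; have [N fN] := limF e e0.
exists (F N) => //; apply: rat_approx_closed => // {e e0 fN} e e0.
pose E : set R := `[- N%:R, N%:R[%classic.
have mE : measurable E by exact: measurable_itv.
have muE : (lebesgue_measure E < +oo)%E.
  rewrite /E lebesgue_measure_itv /= lte_fin.
  by case: ifP => _; rewrite ?ltry// -EFinB ltry.
have fE : lebesgue_measure.-integrable E (EFin \o (f : R -> R)).
  exact: integrableS Df.
have [g_ [cg gE /fine_cvgP[gfin glim]]] := approximation_continuous_integrable mE muE fE.
have /cvgr0Pnorm_lt/(_ _ e0) := glim.
move=> /(filterI gfin)/filter_ex[n [nfin]] /= ne.
exists (fun t => g_ n t * itvfun (- N%:R) N%:R t); first exact: rat_approx_continuous.
apply: le_lt_trans ne; apply: le_trans (ler_norm _) _.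
suff -> : L1norm mu (F N - (fun t => g_ n t * itvfun (- N%:R) N%:R t)) =
    fine (\int[lebesgue_measure]_(z in E) `|(f z - g_ n z)%:E|)%E by [].
rewrite integral_mkcond; congr fine; apply: eq_integral => t _.
rewrite patchE -[(_ - _) t]/(f t * itvfun _ _ t - g_ n t * itvfun _ _ t).
rewrite itvfunE mem_setE in_itv /=; case: ifP => _.
  by rewrite !mulr1.
by rewrite !mulr0 subrr normr0.
Qed.

Lemma L1_lebesgue_separable : separable S.
Proof.
apply/separableP; exists (range (fun s => cl (ratstep s))).
  exact: sub_countable (card_image_le _ _) (countableP _).
move=> q e e0; have [f Df ->] := clsW q.
have [s fs] := (rat_approx_all Df).2 e e0; exists (cl (ratstep s)); first by exists s.
have Ds : L1dom mu (ratstep s) by exact: stepfun_dom.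
rewrite (@clsB _ (L1cs mu) _ _ Df Ds) norm_cls//.
exact: (sl_DB sL).
Qed.

Lemma L1_lebesgue_exists : exists (L : banachLatticeType R) (chi : R -> R -> L),
  [/\ separable L, is_L1 L,
      forall a b, a <= b -> vle lat_join 0 (chi a b) /\ `|chi a b| = b - a,
      forall a b c, a <= b -> b <= c -> chi a c = chi a b + chi b c &
      forall a b c, a <= b -> b <= c ->
        vmeet lat_join (chi a b) (chi b c) = 0].
Proof.
exists S, itvcls; split.
- exact: L1_lebesgue_separable.
- exact: is_L1_quot.
- by move=> a b ab; split; [exact: itvcls_ge0|exact: norm_itvcls].
- exact: itvclsD.
- exact: itvcls_disj.
Qed.

End Lebesgue.

(** * Injectivity for spaces of the form [L_1] *)

Lemma L1_universal_disposition_BL_injective (R : realType)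
    (X : banachLatticeType R) : is_L1 X ->
  universal_disposition (fun S => separable S /\ is_L1 S) X ->
  separably_BL_injective 1%R X.
Proof.
move=> X1 uX Y A T sY cA hT.
have [q [sq qM qA qD]] := AL_extension (is_L1_AL_space X1) cA hT.
have [Z [i cZ]] := completion_exists sq.
have [L [chi [sL L1 chi1 chiD chiI]]] := @L1_lebesgue_exists R.
have AZ : AL_space Z by apply: (AL_completion sq cZ) => x y _ _; exact: qD.
(* [Z] is only shown to be an AL-space. Embedding it in [L] puts the target in the class, and the
   norms prescribed by [q] survive because [h] is isometric. *)
have [h [hh hN]] : exists h : Z -> L, embedding h.
  apply: (AL_interval_embedding (chi := chi)) => //.
  - exact: is_L1_AL_space.
  - exact: separable_completion cZ qM sY.
  - by move=> a b /chi1[].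
  - by move=> a b /chi1[].
have hi := cpl_hom cZ qM.
apply: (extension_through (u := h \o i) uX) => //.
- apply: lattice_homP => //=.
  + by move=> a x y _ _; rewrite (lhomL hi)// (lhomL hh).
  + by move=> x y _ _; rewrite (lhomj hi)// (lhomj hh).
  + by exists (opnorm_on A T) => y _; rewrite hN (cpl_norm cZ).
- by move=> a Aa; rewrite /= hN (cpl_norm cZ)// qA.
- by move=> y; rewrite /= hN (cpl_norm cZ).
Qed.

Theorem theorem6p2 (R : realType) :
  (forall X : banachLatticeType R,
     universal_disposition (fun S => separable S) X ->
     separably_BL_injective 1%R X) /\
  (forall X : banachLatticeType R,
     is_L1 X ->
     universal_disposition (fun S => separable S /\ is_L1 S) X ->
     separably_BL_injective 1%R X).
Proof.
split=> X; first exact: universal_disposition_BL_injective.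
exact: L1_universal_disposition_BL_injective.
Qed.
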